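(* (Badiale–Tarantello conjecture.) Let $2\le N\le n$, write $x=(x',x'')\in\mathbb{R}^N\times\mathbb{R}^{n-N}$, and let $1<p<N$. Then for every $f\in C_0^\infty(\mathbb{R}^n\setminus\{x'=0\})$, $$\left\|\frac{f}{|x'|}\right\|_{L^p(\mathbb{R}^n)}\le\frac{p}{N-p}\|\nabla f\|_{L^p(\mathbb{R}^n)},$$ and $\frac{p}{N-p}$ is the best constant, i.e. it cannot be replaced by a smaller constant for which the inequality holds for all such $f$.
   Context: $|x'|$ is the Euclidean norm of $x'\in\mathbb{R}^N$; $\nabla$ is the full standard Euclidean gradient on $\mathbb{R}^n$. $C_0^\infty(U)$ denotes smooth complex-valued functions with compact support in the open set $U$. *)

(* Defs.v *)
From HB Require Import structures.
From mathcomp Require Import all_boot all_order all_algebra.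
From mathcomp Require Import complex.
From mathcomp Require Import all_classical all_reals all_analysis.
From mathcomp Require Import measurable_realfun.

Set Implicit Arguments.
Unset Strict Implicit.
Unset Printing Implicit Defensive.

Import Order.TTheory GRing.Theory Num.Theory.
Import numFieldNormedType.Exports.

Local Open Scope classical_set_scope.
Local Open Scope ring_scope.

Section LebesgueRn.
Context {R : realType}.

(* R^n with its Borel sigma-algebra; convertible to ['rV[R]_n]. *)
Definition borel_rV (n : nat) := g_sigma_algebraType [set U : set 'rV[R]_n | open U].

HB.instance Definition _ n := Measurable.on (borel_rV n).

Definition consrV n (xv : measurableTypeR R * borel_rV n) : borel_rV n.+1 :=
  \row_(i < n.+1)
    if unlift ord0 i is Some j then (xv.2 : 'rV[R]_n) ord0 j else xv.1.

Definition unconsrV n (v : borel_rV n.+1) : measurableTypeR R * borel_rV n :=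
  ((v : 'rV[R]_n.+1) ord0 ord0,
   \row_(j < n) (v : 'rV[R]_n.+1) ord0 (lift ord0 j)).

Lemma consrV0 n (xv : measurableTypeR R * borel_rV n) :
  (consrV xv : 'rV[R]_n.+1) ord0 ord0 = xv.1.
Proof. by rewrite mxE unlift_none. Qed.

Lemma consrVS n (xv : measurableTypeR R * borel_rV n) (j : 'I_n) :
  (consrV xv : 'rV[R]_n.+1) ord0 (lift ord0 j) = (xv.2 : 'rV[R]_n) ord0 j.
Proof. by rewrite mxE liftK. Qed.

Lemma consrVK n : cancel (@consrV n) (@unconsrV n).
Proof.
move=> xv; rewrite /unconsrV consrV0; case: xv => x v /=; congr pair.
by apply/rowP => j; rewrite mxE consrVS.
Qed.

Lemma unconsrVK n : cancel (@unconsrV n) (@consrV n).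
Proof.
move=> v; apply/rowP => j; case: (unliftP ord0 j) => [k|] ->.
  by rewrite consrVS mxE.
by rewrite consrV0.
Qed.

Lemma open_borel_rV n (U : set 'rV[R]_n) :
  open U -> measurable (U : set (borel_rV n)).
Proof. by move=> oU; apply: sub_sigma_algebra. Qed.

Lemma measurable_consrV n : measurable_fun setT (@consrV n).
Proof.
apply: (@measurability _ _ _ (borel_rV n.+1) _ _ _ erefl) => // _ [U oU <-].
rewrite setTI.
pose I := (rat * 'rV[rat]_n * rat)%type.
pose B (i : I) : set (measurableTypeR R * borel_rV n) :=
  ball (ratr i.1.1 : R) (ratr i.2) `*`
  (ball (map_mx ratr i.1.2 : 'rV[R]_n) (ratr i.2 : R)).
have mB i : measurable (B i).
  apply: measurableX; first by exact: measurable_ball.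
  by apply: open_borel_rV; exact: ball_open.
rewrite [X in measurable X](_ : _ =
    \bigcup_(i in [set i | B i `<=` @consrV n @^-1` U]) B i); last first.
  apply/seteqP; split=> [p Up|p [i /= BU] /BU//].
  have /nbhs_ballP[e /= e0 eU] : nbhs (consrV p : 'rV[R]_n.+1) U.
    by move: oU; rewrite openE => /(_ _ Up).
  have [r /itvP rI] : exists r, ratr r \in `]0, (e / 2)[.
    by apply: rat_in_itvoo; rewrite divr_gt0.
  have r0 : 0 < (ratr r : R) by rewrite rI.
  have appr (a : R) : exists q : rat, ball (ratr q : R) (ratr r) a.
    have [|q /itvP qI] := @rat_in_itvoo R (a - ratr r) (a + ratr r).
      by rewrite ltrBlDr -addrA ltrDl addr_gt0.
    by exists q; rewrite /ball /= ltr_distl !qI.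
  have [q hq] := appr p.1.
  have /choice[w hw] := fun j => appr ((p.2 : 'rV[R]_n) ord0 j).
  exists (q, \row_j w j, r).
    move=> p' [/= b1 [_ b2]]; apply: eU; split=> // i j; rewrite ord1.
    case: (unliftP ord0 j) => [k|] ->.
      rewrite !consrVS; apply: (@le_ball _ _ _ (ratr r + ratr r)).
        by rewrite (splitr e) lerD// ltW// rI.
      apply: ball_triangle (b2 ord0 k).
      by apply: ball_sym; rewrite !mxE.
    rewrite !consrV0; apply: (@le_ball _ _ _ (ratr r + ratr r)).
      by rewrite (splitr e) lerD// ltW// rI.
    exact: ball_triangle (ball_sym hq) b1.
  split=> //=; split=> // i j; rewrite ord1 !mxE; exact: hw.
rewrite bigcup_mkcond; apply: countable_bigcupT_measurable => [|i].
  exact: countableP.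
by case: ifPn.
Qed.

Lemma open_unconsrV2 n (U : set 'rV[R]_n) : open U ->
  open [set v : 'rV[R]_n.+1 | U (\row_(j < n) v ord0 (lift ord0 j))].
Proof.
rewrite !openE => oU v /oU /nbhs_ballP[e /= e0 eU].
apply/nbhs_ballP; exists e => // w [_ vw]; apply: eU; split=> // i j.
by rewrite !mxE.
Qed.

Lemma measurable_coord_rV n (i : 'I_n) :
  measurable_fun setT (fun x : borel_rV n => (x : 'rV[R]_n) ord0 i : measurableTypeR R).
Proof.
apply: (measurability _ (RGenOpens.measurableE R)) => _ [_ [a [b ->] <-]].
rewrite setTI; apply: open_borel_rV.
by apply: open_comp; [move=> v _; exact: coord_continuous|exact: interval_open].
Qed.

Lemma measurable_unconsrV n : measurable_fun setT (@unconsrV n).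
Proof.
apply: measurable_fun_pair; first exact: measurable_coord_rV.
apply: (@measurability _ _ _ (borel_rV n) _ _ _ erefl) => // _ [U oU <-].
rewrite setTI; apply: open_borel_rV; exact: open_unconsrV2.
Qed.

Definition lebesgue_rVS n (mu : {sigma_finite_measure set (borel_rV n) -> \bar R})
  : set (borel_rV n.+1) -> \bar R :=
  pushforward (lebesgue_measure \x mu)%E (@consrV n).

Section lebesgue_rVS.
Variables (n : nat) (mu : {sigma_finite_measure set (borel_rV n) -> \bar R}).

Local Notation nu := (pushforward (lebesgue_measure \x mu)%E (@consrV n)).
Let mconsrV := @measurable_consrV n.

Let lebesgue_rVS0 : lebesgue_rVS mu set0 = 0%E.
Proof. exact: (measure0 nu). Qed.

Let lebesgue_rVS_ge0 A : (0 <= lebesgue_rVS mu A)%E.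
Proof. exact: (measure_ge0 nu). Qed.

Let lebesgue_rVS_sigma_additive : semi_sigma_additive (lebesgue_rVS mu).
Proof. exact: (@measure_semi_sigma_additive _ _ _ nu). Qed.

HB.instance Definition _ := isMeasure.Build _ _ _ (lebesgue_rVS mu)
  lebesgue_rVS0 lebesgue_rVS_ge0 lebesgue_rVS_sigma_additive.

Lemma sigma_finite_lebesgue_rVS : sigma_finite setT (lebesgue_rVS mu).
Proof.
have /sigma_finiteP[F [FT ndF Foo]] := sigma_finiteT (@lebesgue_measure R).
have /sigma_finiteP[G [GT ndG Goo]] := sigma_finiteT mu.
exists (fun k => @unconsrV n @^-1` (F k `*` G k)).
  rewrite -preimage_bigcup; apply/seteqP; split=> // v _ /=.
  have [i _ Fi] : (\bigcup_i F i) (unconsrV v).1 by rewrite -FT.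
  have [j _ Gj] : (\bigcup_j G j) (unconsrV v).2 by rewrite -GT.
  exists (maxn i j) => //; split.
    by move: Fi; exact/subsetPset/ndF/leq_maxl.
  by move: Gj; exact/subsetPset/ndG/leq_maxr.
move=> k; have [mF oF] := Foo k; have [mG oG] := Goo k; split.
  rewrite -[X in measurable X]setTI; apply: measurable_unconsrV => //.
  exact: measurableX.
rewrite /lebesgue_rVS /pushforward -comp_preimage.
rewrite (_ : _ \o _ = id); last by apply/funext => x /=; rewrite consrVK.
by rewrite preimage_id product_measure1E// lte_mul_pinfty// ge0_fin_numE.
Qed.

HB.instance Definition _ := Measure_isSigmaFinite.Build _ _ _
  (lebesgue_rVS mu) sigma_finite_lebesgue_rVS.

End lebesgue_rVS.

(* Lebesgue measure on R^n: R^0 is a point of mass 1, and the measure on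
   R^(n+1) is the product measure, carried over by R * R^n ~ R^(n+1). *)
Fixpoint lebesgue_rV (n : nat) : {sigma_finite_measure set (borel_rV n) -> \bar R} :=
  match n with
  | 0 => dirac ((0 : 'rV[R]_0) : borel_rV 0)
  | m.+1 => lebesgue_rVS (lebesgue_rV m)
  end.

Definition box_rV n (a b : 'rV[R]_n) : set (borel_rV n) :=
  [set x : 'rV[R]_n | forall i, a ord0 i <= x ord0 i <= b ord0 i].

Lemma measurable_box_rV n (a b : 'rV[R]_n) : measurable (box_rV a b).
Proof.
rewrite (_ : box_rV a b = \bigcap_i (setT `&`
    (fun x : borel_rV n => (x : 'rV[R]_n) ord0 i) @^-1`
    `[a ord0 i, b ord0 i])).
  apply: fin_bigcap_measurable => // i _.
  by apply: measurable_coord_rV => //; exact: measurable_itv.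
apply/seteqP; split=> [x ab i _|x ab i].
  by rewrite setTI /= in_itv /=; exact: ab.
by have := ab i I; rewrite setTI /= in_itv.
Qed.

Lemma lebesgue_rV_box n (a b : 'rV[R]_n) : (forall i, a ord0 i <= b ord0 i) ->
  lebesgue_rV n (box_rV a b) = (\prod_(i < n) (b ord0 i - a ord0 i))%:E.
Proof.
elim: n a b => [|n IHn] a b ab /=.
  by rewrite big_ord0 diracE mem_set// => -[].
rewrite /lebesgue_rVS /pushforward big_ord_recl.
pose c (a : 'rV[R]_n.+1) := \row_(j < n) a ord0 (lift ord0 j).
rewrite (_ : _ @^-1` _ = `[a ord0 ord0, b ord0 ord0] `*` box_rV (c a) (c b)).
  rewrite product_measure1E//; last exact: measurable_box_rV.
  rewrite IHn => [|i]; last by rewrite !mxE.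
  have L : lebesgue_measure `[a ord0 ord0, b ord0 ord0] =
      (b ord0 ord0 - a ord0 ord0)%:E.
    rewrite lebesgue_measure_itv /= lte_fin.
    have := ab ord0; rewrite le_eqVlt => /predU1P[->|->]; last by [].
    by rewrite ltxx subrr.
  rewrite EFinM; congr (_ * _)%E; first exact: L.
  by congr EFin; apply: eq_bigr => j _; rewrite !mxE.
apply/seteqP; split=> -[x v] /=.
  move=> B; split=> [|j]; first by have := B ord0; rewrite consrV0 in_itv.
  by have := B (lift ord0 j); rewrite consrVS !mxE.
move=> [+ B] i; case: (unliftP ord0 i) => [j|] ->.
  by have := B j; rewrite consrVS !mxE.
by rewrite consrV0 in_itv.
Qed.

End LebesgueRn.

(* The library norm on ['rV[R]_k] is the max norm. *)
Definition enorm (R : realType) k (v : 'rV[R]_k) : R :=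
  Num.sqrt (\sum_(i < k) v ord0 i ^+ 2).

(* Euclidean norm of C^k; [normc] is the R-valued modulus of a complex number. *)
Definition cenorm (R : realType) k (v : 'rV[R[i]]_k) : R :=
  Num.sqrt (\sum_(i < k) Normc.normc (v ord0 i) ^+ 2).

(* x' for x = (x', x'') : the first N coordinates of x *)
Definition fst_coords (R : realType) (N n : nat) (leNn : (N <= n)%N)
    (x : 'rV[R]_n) : 'rV[R]_N :=
  \row_(i < N) x ord0 (widen_ord leNn i).

Section Smooth.
Context {R : realType} {n : nat}.

Definition partial (i : 'I_n) (u : 'rV[R]_n -> R) : 'rV[R]_n -> R :=
  'D_(delta_mx ord0 i) u.

(* C^k: all partial derivatives up to order k exist everywhere and are continuous. *)
Fixpoint Ck (k : nat) (u : 'rV[R]_n -> R) : Prop :=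
  match k with
  | 0 => continuous u
  | m.+1 => continuous u /\
      forall i : 'I_n, (forall x, derivable u x (delta_mx ord0 i)) /\ Ck m (partial i u)
  end.

(* R[i] carries no real normed module structure, so functions with values in it
   are differentiated through their real and imaginary parts. *)
Definition csmooth (f : 'rV[R]_n -> R[i]) : Prop :=
  forall k, Ck k (fun x => complex.Re (f x)) /\ Ck k (fun x => complex.Im (f x)).

Definition cgrad (f : 'rV[R]_n -> R[i]) (x : 'rV[R]_n) : 'rV[R[i]]_n :=
  \row_(i < n) (partial i (fun y => complex.Re (f y)) x +i*
                partial i (fun y => complex.Im (f y)) x)%C.

Definition csupport (f : 'rV[R]_n -> R[i]) : set 'rV[R]_n :=
  closure [set x | f x != 0].

(* C_0^oo(U) for U open, its elements being extended by 0 outside U *)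
Definition test_fun (U : set 'rV[R]_n) (f : 'rV[R]_n -> R[i]) : Prop :=
  [/\ csmooth f, compact (csupport f) & csupport f `<=` U].

(* L^p norm over R^n, with values in [0, +oo] *)
Definition LpRn (p : R) (g : 'rV[R]_n -> R) : \bar R :=
  Lnorm (lebesgue_rV n) p%:E (fun x : borel_rV n => (g x)%:E).

End Smooth.

(* Main.v *)
Require Import Defs.
From mathcomp Require Import all_boot all_order all_algebra.
From mathcomp Require Import complex.
From mathcomp Require Import all_classical all_reals all_analysis.
From mathcomp Require Import measurable_realfun ring lra.
Import Order.TTheory GRing.Theory Num.Theory.
Import numFieldNormedType.Exports.
Local Open Scope classical_set_scope.
Local Open Scope ring_scope.

Set Implicit Arguments.
Unset Strict Implicit.
Unset Printing Implicit Defensive.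

(** Write [s = |x'|^2] and [C = p / (N - p)].

    The inequality.  Off [x' = 0] the field [x' / |x'|^p] of R^N has divergence
    [(N - p) / |x'|^p].  Multiplied by [|f|^p] it becomes a compactly supported
    C^1 field, because [p > 1], and so its divergence has integral [0]
    ([integral_derive_rV]).  Expanding this divergence and using
    Cauchy-Schwarz gives [(N - p) (|f|/|x'|)^p] on one side and
    [p (|f|/|x'|)^(p-1) |grad f|] on the other; Young's inequality with the
    right weight makes this the pointwise estimate [pointwise_hardy]
      [(1 / C) (|f|/|x'|)^p <= divergence + C^(p-1) |grad f|^p],
    and integration yields [hardy_inequality].

    The constant.  Equality would require [f = |x'|^(-2a)] with
    [2 a = (N - p) / p = 1 / C], for which [|grad f| = 2 a |f| / |x'|], but then
    [(|f|/|x'|)^p = |x'|^(-N)] is not integrable, neither at [0] nor at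
    infinity, and logarithmically so.  The test functions [bump] cut this power
    off smoothly at [|x'| ~ 1], at [|x'| ~ k] and at [|x''| ~ L].  By scaling,
    each cutoff in [x'] adds to the gradient an error whose norm has a p-th
    power [O(L^(n-N))], uniformly in [k], and so does the cutoff in [x''] when
    [L] is large ([cgrad_cbump_le]); whereas the integral of [(|f|/|x'|)^p] is
    at least of order [L^(n-N) log k], as one sees on disjoint boxes of sizes
    [4^j], each of which contributes equally ([integral_hardy_quotient_ge]).  A
    constant smaller than [C] in the inequality would bound this logarithm
    ([sharpness_growth_bound]). *)

(** * Derivatives along a direction *)

Section DirectionalDerivative.
Context {R : realType} {V : normedModType R}.
Implicit Types (f g u : V -> R) (x v : V).

(** Reduces a derivative along [v] to a derivative on the real line, where the
    chain rule for one-variable functions is available. *)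
Lemma is_derive_line f x v df :
  is_derive x v f df <-> is_derive (0 : R) 1 (fun t : R => f (t *: v + x)) df.
Proof.
have E : 'D_v f x = 'D_1 (fun t : R => f (t *: v + x)) 0.
  rewrite /derive; set g1 := fun h => h^-1 *: _; set g2 := fun h => h^-1 *: _.
  suff -> : g1 = g2 by [].
  by apply/funext => h; rewrite /g1 /g2 /= addr0 scale0r add0r [_%:A]mulr1.
split=> -[df1 dfE]; split; [|by rewrite -E| |by rewrite E].
  exact: (derivable1P _ _ _).1 df1.
exact: (derivable1P _ _ _).2 df1.
Qed.

Lemma is_derive_chain u (h : R -> R) x v du dh :
  is_derive x v u du -> is_derive (u x) 1 h dh ->
  is_derive x v (fun y => h (u y)) (dh * du).
Proof.
move=> /is_derive_line du1 dh1; apply/is_derive_line.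
have u0 : u (0 *: v + x) = u x by rewrite scale0r add0r.
have du2 : derivable (fun t : R => u (t *: v + x)) 0 1 by exact: ex_derive.
have dh2 : derivable h ((fun t : R => u (t *: v + x)) 0) 1.
  by rewrite u0; exact: ex_derive.
split.
  by apply/derivable1_diffP/differentiable_comp; exact/derivable1_diffP.
rewrite -derive1E (derive1_comp du2 dh2) u0 !derive1E.
by rewrite (@derive_val _ _ _ _ _ _ _ dh1) (@derive_val _ _ _ _ _ _ _ du1).
Qed.

Lemma is_deriveD_fun f g x v df dg : is_derive x v f df -> is_derive x v g dg ->
  is_derive x v (fun y => f y + g y) (df + dg).
Proof. exact: is_deriveD. Qed.

Lemma is_deriveM_fun f g x v df dg : is_derive x v f df -> is_derive x v g dg ->
  is_derive x v (fun y => f y * g y) (df * g x + f x * dg).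
Proof.
move=> Hf Hg; have := is_deriveM Hf Hg.
by move/is_derive_eq; apply; rewrite /GRing.scale /= addrC [g x * _]mulrC.
Qed.

End DirectionalDerivative.

(** * Functions of class C^k *)

Section SmoothFunctions.
Context {R : realType}.

(** At a zero of [f] the difference quotient is [f (t v + x) / t] itself, so an
    estimate [f (t v + x) = o(t)] is all that is needed. *)
Lemma is_derive0_small (V : normedModType R) (f : V -> R) x v (e : R -> R) :
  f x = 0 -> (forall t, t != 0 -> `|f (t *: v + x)| <= `|t| * e t) ->
  e t @[t --> 0^'] --> 0 -> is_derive x v f 0.
Proof.
move=> fx0 fe e0.
have h0 : h^-1 *: ((f \o shift x) (h *: v) - f x) @[h --> 0^'] --> (0 : R).
  apply/norm_cvg0P; apply: (squeeze_cvgr _ (cvg_cst 0) e0).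
  near=> t; have t0 : t != 0 by near: t; exact: nbhs_dnbhs_neq.
  rewrite normr_ge0 /= fx0 subr0 /GRing.scale /= normrM normfV.
  by rewrite ler_pdivrMl ?normr_gt0// fe.
by split; [apply/cvg_ex; exists 0|exact: cvg_lim h0].
Unshelve. all: by end_near. Qed.

Lemma is_derive_continuous (h : R -> R) (t dh : R) :
  is_derive t 1 h dh -> {for t, continuous h}.
Proof.
by move=> [dh1 _]; apply/differentiable_continuous/derivable1_diffP.
Qed.

Section Ck.
Context {n : nat}.
Implicit Types (u w : 'rV[R]_n -> R).

Lemma Ck_continuous k u : Ck k u -> continuous u.
Proof. by case: k => [//|k] []. Qed.
Arguments Ck_continuous [k u] _ x.

Lemma CkW k u : Ck k.+1 u -> Ck k u.
Proof.
elim: k u => [|k IH] u [cu Hu]; first by [].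
by split=> // i; have [du Cu] := Hu i; split => //; exact: IH.
Qed.

Lemma CkS_intro k u (du : 'I_n -> 'rV[R]_n -> R) : continuous u ->
  (forall i x, is_derive x (delta_mx ord0 i) u (du i x)) ->
  (forall i, Ck k (du i)) -> Ck k.+1 u.
Proof.
move=> cu Du Cdu; split=> // i; split=> [x|].
  by case: (Du i x).
by rewrite (_ : partial i u = du i)//; apply/funext => x; case: (Du i x).
Qed.

Lemma Ck_derive k u i x : Ck k.+1 u ->
  is_derive x (delta_mx ord0 i) u (partial i u x).
Proof. by case=> _ /(_ i)[+ _] => /(_ x); exact: derivableP. Qed.

Lemma Ck_cst k (c : R) : Ck k (fun _ : 'rV[R]_n => c).
Proof.
elim: k c => [|k IH] c; first by move=> x; exact: cst_continuous.
by apply: (@CkS_intro _ _ (fun _ _ => 0)) => [x|_]; [exact: cst_continuous|].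
Qed.

Lemma Ck_add k u w : Ck k u -> Ck k w -> Ck k (fun x => u x + w x).
Proof.
elim: k u w => [|k IH] u w Cu Cw.
  by move=> x; exact: (cvgD (Ck_continuous Cu x) (Ck_continuous Cw x)).
apply: (@CkS_intro _ _ (fun i x => partial i u x + partial i w x)) => [x|i x|i].
- by exact: (cvgD (Ck_continuous Cu x) (Ck_continuous Cw x)).
- exact: is_deriveD_fun (Ck_derive i x Cu) (Ck_derive i x Cw).
- by apply: IH; [case: Cu => _ /(_ i)[]|case: Cw => _ /(_ i)[]].
Qed.

Lemma Ck_mul k u w : Ck k u -> Ck k w -> Ck k (fun x => u x * w x).
Proof.
elim: k u w => [|k IH] u w Cu Cw.
  by move=> x; exact: (cvgM (Ck_continuous Cu x) (Ck_continuous Cw x)).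
apply: (@CkS_intro _ _ (fun i x => partial i u x * w x + u x * partial i w x))
  => [x|i x|i].
- by exact: (cvgM (Ck_continuous Cu x) (Ck_continuous Cw x)).
- exact: is_deriveM_fun (Ck_derive i x Cu) (Ck_derive i x Cw).
- apply: Ck_add; apply: IH; try exact: CkW.
    by case: Cu => _ /(_ i)[].
  by case: Cw => _ /(_ i)[].
Qed.

Lemma Ck_sum k m (P : pred 'I_m) (u : 'I_m -> 'rV[R]_n -> R) :
  (forall j, Ck k (u j)) -> Ck k (fun x => \sum_(j < m | P j) u j x).
Proof.
move=> Cu; rewrite (_ : (fun x => _) = \sum_(j < m | P j) u j); last first.
  by apply/funext => x; rewrite fct_sumE.
elim/big_ind : _ => //; first exact: Ck_cst.
by move=> f g; exact: Ck_add.
Qed.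

Lemma is_derive_coord (j i : 'I_n) (x : 'rV[R]_n) :
  is_derive x (delta_mx ord0 i) (fun y : 'rV[R]_n => y ord0 j) (j == i)%:R.
Proof.
apply/is_derive_line.
rewrite (_ : (fun t => _) = fun t => t * (j == i)%:R + x ord0 j); last first.
  by apply/funext => t; rewrite !mxE eqxx.
have := is_deriveD_fun (is_deriveM_fun (is_derive_id (0:R) 1)
  (is_derive_cst ((j == i)%:R : R) (0:R) 1)) (is_derive_cst (x ord0 j) (0:R) 1).
by move/is_derive_eq; apply; rewrite addr0 mulr0 addr0 mul1r.
Qed.

Lemma Ck_coord k (j : 'I_n) : Ck k (fun y : 'rV[R]_n => y ord0 j).
Proof.
case: k => [|k]; first by move=> x; exact: coord_continuous.
apply: (@CkS_intro _ _ (fun i _ => (j == i)%:R)) => [x|i x|i].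
- exact: coord_continuous.
- exact: is_derive_coord.
- exact: Ck_cst.
Qed.

(** [D] lists the successive derivatives of the outer function [D j].  Asking
    for them on a set [A] that contains the values of [u] covers functions,
    such as powers, that are smooth on a half-line only. *)
Lemma Ck_comp (D : nat -> R -> R) (A : set R) u k j :
  (forall i t, A t -> is_derive t 1 (D i) (D i.+1 t)) ->
  (forall x, A (u x)) -> Ck k u -> Ck k (fun x => D j (u x)).
Proof.
move=> DD Au; elim: k j => [|k IH] j Cu.
  move=> x; apply: continuous_comp; first exact: (Ck_continuous Cu).
  exact: is_derive_continuous (DD _ _ (Au x)).
apply: (@CkS_intro _ _ (fun i x => D j.+1 (u x) * partial i u x)) => [x|i x|i].
- apply: continuous_comp; first exact: (Ck_continuous Cu).
  exact: is_derive_continuous (DD _ _ (Au x)).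
- exact: is_derive_chain (Ck_derive i x Cu) (DD _ _ (Au x)).
- by apply: Ck_mul; [exact/IH/CkW|case: Cu => _ /(_ i)[]].
Qed.

End Ck.
End SmoothFunctions.

(** * A smooth cutoff on the line *)

Section SmoothCutoff.
Context {R : realType}.
Implicit Types (P : {poly R}) (t y : R).

(** [t |-> P(1/t) exp(-1/t)], extended by [0] to the negative half-line.  This
    family is stable under differentiation, [flat_next P] being the polynomial
    of the derivative; it thus contains all the derivatives of [exp(-1/t)]. *)
Definition flat_fun P t : R := if 0 < t then P.[t^-1] * expR (- t^-1) else 0.

Definition flat_next P : {poly R} := 'X^2 * (P - P^`()).

Lemma exprn_le_expR y i : 0 <= y -> y ^+ i <= i`!%:R * expR y.
Proof.
case: i => [|i] y0; first by rewrite expr0 mul1r -expR0 ler_expR.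
have f0 : 0 < (i.+1`!)%:R :> R by rewrite ltr0n fact_gt0.
rewrite -ler_pdivrMl// mulrC (le_trans _ (expR_ge1Dxn i y0))//.
by rewrite lerDr.
Qed.

Lemma horner_expR_bounded P :
  exists C : R, forall y, 0 <= y -> `|P.[y]| * expR (- y) <= C.
Proof.
exists (\sum_(i < size P) `|P`_i| * i`!%:R) => y y0.
rewrite horner_coef expRN ler_pdivrMr ?expR_gt0// mulr_suml.
rewrite (le_trans (ler_norm_sum _ _ _))// ler_sum// => i _.
rewrite normrM normrX (ger0_norm y0) -mulrA ler_wpM2l//.
exact: exprn_le_expR.
Qed.

(** The point [t = 0] is the only delicate one: there [P(1/t) exp(-1/t)] is
    [O(t^2)], because [y^2 P(y) exp(-y)] is bounded for [y = 1/t >= 0]. *)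
Lemma is_derive_flat_fun P t :
  is_derive t 1 (flat_fun P) (flat_fun (flat_next P) t).
Proof.
have [t0|t0|<-{t}] := ltgtP 0 t.
- have ti : is_derive t 1 (fun z : R => z^-1) (- t ^- 2).
    have tn : t != 0 by rewrite gt_eqF.
    split; first by apply: derivableV => //; exact: derivable_id.
    by rewrite deriveV// derive_id /GRing.scale /= mulr1.
  have tN : is_derive t 1 (fun z : R => - z^-1) (t ^- 2).
    by have := is_deriveN ti; move/is_derive_eq; apply; rewrite opprK.
  have H := is_deriveM_fun (is_derive_chain ti (is_derive_poly P t^-1))
    (is_derive_chain tN (is_derive_expR (- t^-1))).
  rewrite /flat_fun t0.
  refine (@near_eq_is_derive R R R
    (fun z => P.[z^-1] * expR (- z^-1)) _ _ _ _ _ _) => /=.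
    by near=> z; rewrite ifT//; near: z; exact: lt_nbhsr.
  apply: is_derive_eq H _.
  by rewrite /flat_next !hornerE /= exprVn; ring.
- rewrite /flat_fun ltNge (ltW t0) /=.
  refine (@near_eq_is_derive R R R (fun=> 0) _ _ _ _ _ _).
  by near=> z; rewrite ifF// ltNge; apply/negbF/ltW; near: z; exact: lt_nbhsl.
- have [C HC] := horner_expR_bounded (P * 'X^2).
  rewrite {2}/flat_fun ltxx.
  apply: (@is_derive0_small _ _ _ _ _ (fun t => `|t| * `|C|)).
  + by rewrite /flat_fun ltxx.
  + move=> t tn0; rewrite addr0 [_ *: _]mulr1 /flat_fun.
    case: ifPn => [t0|_]; last by rewrite normr0 !mulr_ge0.
    have := HC t^-1; rewrite invr_ge0 (ltW t0) => /(_ isT).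
    rewrite hornerM hornerXn normrM normrX normfV exprVn normrM.
    rewrite (gtr0_norm (expR_gt0 _)).
    rewrite mulrAC ler_pdivrMr ?exprn_gt0 ?normr_gt0// => /le_trans; apply.
    by rewrite mulrA -expr2 mulrC ler_wpM2l ?exprn_ge0// ler_norm.
  + rewrite -[X in _ --> X](mul0r `|C|).
    apply: cvgM; last exact: cvg_cst.
    apply: cvg_within_filter.
    by have := @norm_continuous _ R (0 : R); rewrite /continuous_at normr0.
Unshelve. all: by end_near. Qed.

Definition expinv_derive k : R -> R := flat_fun (iter k flat_next 1).

(** The function [exp(-1/t)] for [t > 0], and [0] for [t <= 0]. *)
Definition expinv : R -> R := expinv_derive 0.

Lemma is_derive_expinv k t :
  is_derive t 1 (expinv_derive k) (expinv_derive k.+1 t).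
Proof. exact: is_derive_flat_fun. Qed.

Lemma expinvE t : expinv t = if 0 < t then expR (- t^-1) else 0.
Proof. by rewrite /expinv /expinv_derive /flat_fun /= hornerC mul1r. Qed.

Lemma expinv_derive1E t :
  expinv_derive 1 t = if 0 < t then t^-1 ^+ 2 * expR (- t^-1) else 0.
Proof.
rewrite /expinv_derive /flat_fun /= /flat_next.
by rewrite (derivC 1) subr0 mulr1 hornerXn.
Qed.

Lemma expinv_ge0 t : 0 <= expinv t.
Proof. by rewrite expinvE; case: ifP => // _; exact: expR_ge0. Qed.

Lemma expinv_gt0 t : 0 < t -> 0 < expinv t.
Proof. by move=> t0; rewrite expinvE t0 expR_gt0. Qed.

Lemma expinv_eq0 t : t <= 0 -> expinv t = 0.
Proof. by move=> t0; rewrite expinvE ltNge t0. Qed.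

Lemma expinv_le1 t : expinv t <= 1.
Proof.
rewrite expinvE; case: ifP => // t0.
by rewrite expR_le1 oppr_le0 invr_ge0 ltW.
Qed.

Lemma expinv1_le t : 1 <= t -> expinv 1 <= expinv t.
Proof.
move=> t1; have t0 : 0 < t by exact: lt_le_trans t1.
by rewrite !expinvE ltr01 t0 ler_expR lerN2 lef_pV2// posrE.
Qed.

Lemma expinv_derive1_le0 t : t <= 0 -> expinv_derive 1 t = 0.
Proof. by move=> t0; rewrite expinv_derive1E ltNge t0. Qed.

Lemma norm_expinv_derive1 t : `|expinv_derive 1 t| <= 2.
Proof.
rewrite expinv_derive1E; case: ifP => [t0|_]; last by rewrite normr0.
have y0 : 0 <= t^-1 by rewrite invr_ge0 ltW.
rewrite ger0_norm ?mulr_ge0 ?exprn_ge0 ?expR_ge0//.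
by rewrite expRN ler_pdivrMr ?expR_gt0// exprn_le_expR.
Qed.

(** A smooth step obtained by composition only: for [t <= 0] the inner argument
    is nonpositive, hence the value is [0]; for [t >= 1] the term
    [expinv (1 - t)] vanishes, hence the value is the positive constant
    [expinv (expinv 1)].  The step is not normalized to [1], since the
    inequalities it is used in are homogeneous. *)
Definition cutoff t := expinv (expinv 1 - expinv (1 - t)).

Definition cutoff_derive t :=
  expinv_derive 1 (expinv 1 - expinv (1 - t)) * expinv_derive 1 (1 - t).

Lemma is_derive_cutoff t : is_derive t 1 cutoff (cutoff_derive t).
Proof.
have H1 : is_derive t 1 (fun z : R => 1 - z) (- 1).
  have := is_deriveB (is_derive_cst (1 : R) t 1) (is_derive_id t 1).
  by move/is_derive_eq; apply; rewrite sub0r.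
have H2 := is_derive_chain H1 (is_derive_expinv 0 (1 - t)).
have H3 := is_deriveB (is_derive_cst (expinv 1 : R) t 1) H2.
have := is_derive_chain H3 (is_derive_expinv 0 _).
by move/is_derive_eq; apply; rewrite /cutoff_derive; ring.
Qed.

Lemma cutoff_ge0 t : 0 <= cutoff t. Proof. exact: expinv_ge0. Qed.

Lemma cutoff_le1 t : cutoff t <= 1. Proof. exact: expinv_le1. Qed.

Lemma cutoff0 t : t <= 0 -> cutoff t = 0.
Proof.
by move=> t0; rewrite /cutoff expinv_eq0// subr_le0 expinv1_le// lerBrDl gerDr.
Qed.

Lemma cutoff1 t : 1 <= t -> cutoff t = expinv (expinv 1).
Proof.
by move=> t1; rewrite /cutoff (@expinv_eq0 (1 - t)) ?subr0// subr_le0.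
Qed.

Lemma cutoff1_gt0 : 0 < expinv (expinv 1).
Proof. exact/expinv_gt0/expinv_gt0. Qed.

Lemma cutoff_derive0 t : t <= 0 -> cutoff_derive t = 0.
Proof.
move=> t0; rewrite /cutoff_derive expinv_derive1_le0 ?mul0r//.
by rewrite subr_le0 expinv1_le// lerBrDl gerDr.
Qed.

Lemma cutoff_derive1 t : 1 <= t -> cutoff_derive t = 0.
Proof.
move=> t1; rewrite /cutoff_derive (@expinv_derive1_le0 (1 - t)) ?mulr0//.
by rewrite subr_le0.
Qed.

Lemma norm_cutoff_derive t : `|cutoff_derive t| <= 4.
Proof.
rewrite normrM (_ : 4 = 2 * 2); last by rewrite -natrM.
by rewrite ler_pM// norm_expinv_derive1.
Qed.

Lemma Ck_cutoff n k (u : 'rV[R]_n -> R) :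
  Ck k u -> Ck k (fun x => cutoff (u x)).
Proof.
move=> Cu.
have Cexp (w : 'rV[R]_n -> R) : Ck k w -> Ck k (fun x => expinv (w x)).
  apply: (@Ck_comp _ _ expinv_derive setT _ _ 0) => // i t _.
  exact: is_derive_expinv.
have CB (c : R) (w : 'rV[R]_n -> R) : Ck k w -> Ck k (fun x => c - w x).
  move=> Cw; apply: Ck_add; first exact: Ck_cst.
  rewrite (_ : (fun x => - w x) = fun x => -1 * w x); last first.
    by apply/funext => x; rewrite mulN1r.
  by apply: Ck_mul => //; exact: Ck_cst.
by apply: (Cexp); apply: (CB); apply: (Cexp); exact: CB.
Qed.

End SmoothCutoff.

(** * Integration over R^n *)

Section IntegralRn.
Context {R : realType}.

Definition vanishes_off n (B : R) (u : 'rV[R]_n -> R) :=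
  forall (x : 'rV[R]_n) i, B < `|x ord0 i| -> u x = 0.

Lemma measurable_continuous_rV n (u : 'rV[R]_n -> R) : continuous u ->
  measurable_fun setT (u : borel_rV n -> measurableTypeR R).
Proof.
move=> cu.
apply: (measurability _ (RGenOpens.measurableE R)) => _ [_ [a [b ->] <-]].
rewrite setTI; apply: open_borel_rV.
by apply: open_comp; [move=> v _; exact: cu|exact: interval_open].
Qed.

Lemma compact_box_rV n (a b : 'rV[R]_n) : compact (box_rV a b : set 'rV[R]_n).
Proof.
have := @rV_compact R n (fun i => `[a ord0 i, b ord0 i]%classic)
  (fun i => @segment_compact R _ _).
congr compact; apply/seteqP; split => x /= H i; have := H i;
  by rewrite in_itv.
Qed.

Lemma lebesgue_rV_box_lty n (a b : 'rV[R]_n) :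
  (lebesgue_rV n (box_rV a b) < +oo)%E.
Proof.
have [ab|] := pselect (forall i, a ord0 i <= b ord0 i).
  by rewrite lebesgue_rV_box// ltry.
move=> /existsNP[i ab]; rewrite (_ : box_rV a b = set0) ?measure0//.
by rewrite -subset0 => x /(_ i) /andP[/le_trans] /[apply].
Qed.

Lemma integral_le_box n (w : 'rV[R]_n -> R) (M : R) (a b : 'rV[R]_n) :
  measurable_fun setT (w : borel_rV n -> measurableTypeR R) -> 0 <= M ->
  (forall x, 0 <= w x <= M * \1_(box_rV a b) x) ->
  (\int[lebesgue_rV n]_x (w x)%:E <= M%:E * lebesgue_rV n (box_rV a b))%E.
Proof.
move=> mw M0 wM; have mA := measurable_box_rV a b.
have mI : measurable_fun setT
    (fun x : borel_rV n => (\1_(box_rV a b) x : R)%:E).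
  by apply/measurable_EFinP.
apply: (@le_trans _ _
    (\int[lebesgue_rV n]_x (M%:E * (\1_(box_rV a b) x)%:E))%E).
  apply: ge0_le_integral => //.
  - by move=> x _; rewrite lee_fin; case/andP: (wM x).
  - exact/measurable_EFinP.
  - exact: measurable_funeM.
  - by move=> x _; rewrite -EFinM lee_fin; case/andP: (wM x).
by rewrite ge0_integralZl_EFin// integral_indic// setIT.
Qed.

Lemma not_box_rV n (B : R) (x : 'rV[R]_n) :
  ~ box_rV (const_mx (- B)) (const_mx B) x -> exists i, B < `|x ord0 i|.
Proof.
apply: contra_notP => nE i; rewrite !mxE -ler_norml leNgt.
by apply/negP => xi; apply: nE; exists i.
Qed.

Lemma integrable_bounded_rV n (u : 'rV[R]_n -> R) (B M : R) :
  measurable_fun setT (u : borel_rV n -> measurableTypeR R) ->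
  vanishes_off B u -> (forall x, `|u x| <= M) ->
  (lebesgue_rV n).-integrable setT (fun x : borel_rV n => (u x)%:E).
Proof.
move=> mu vu uM; apply/integrableP; split; first exact/measurable_EFinP.
have M0 : 0 <= M by exact: le_trans (uM 0).
apply: le_lt_trans (@integral_le_box n (fun x => `|u x|) M (const_mx (- B))
  (const_mx B) _ M0 _) _.
- exact: measurableT_comp.
- move=> x; rewrite normr_ge0 /= indicE.
  have [_|xA] := boolP (x \in _); first by rewrite mulr1 uM.
  have [i xi] : exists i, B < `|x ord0 i|.
    by apply: not_box_rV; move/mem_set; exact/negP.
  by rewrite (vu x i)// normr0 mulr0.
- by rewrite lte_mul_pinfty// lebesgue_rV_box_lty.
Qed.

Lemma bounded_vanishes_off n (u : 'rV[R]_n -> R) (B : R) :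
  continuous u -> vanishes_off B u -> exists M, forall x, `|u x| <= M.
Proof.
move=> cu vu.
pose A : set 'rV[R]_n := box_rV (const_mx (- B)) (const_mx B).
have /compact_bounded [M [Mr HM]] : compact (u @` A).
  apply: continuous_compact; last exact: compact_box_rV.
  exact: continuous_subspaceT.
exists (`|M| + 1) => x; have [Ax|] := pselect (A x).
  apply: (HM (`|M| + 1)); last by exists x.
  by rewrite (le_lt_trans (ler_norm _))// ltrDl.
by move=> /not_box_rV[i xi]; rewrite (vu x i)// normr0 addr_ge0.
Qed.

Lemma integrable_continuous_rV n (u : 'rV[R]_n -> R) (B : R) :
  continuous u -> vanishes_off B u ->
  (lebesgue_rV n).-integrable setT (fun x : borel_rV n => (u x)%:E).
Proof.
move=> cu vu; have [M uM] := bounded_vanishes_off cu vu.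
by apply: integrable_bounded_rV vu uM; exact: measurable_continuous_rV.
Qed.

Lemma integrable_consrV n (u : borel_rV n.+1 -> \bar R) :
  (lebesgue_rV n.+1).-integrable setT u ->
  (lebesgue_measure \x lebesgue_rV n)%E.-integrable setT (u \o @consrV R n).
Proof.
move=> /integrableP[mu fu]; apply/integrableP; split.
  by apply: measurableT_comp => //; exact: measurable_consrV.
move: fu; rewrite [X in (X < _)%E -> _]
  (@eq_measure_integral _ _ _ _
    (pushforward (lebesgue_measure \x lebesgue_rV n)%E (@consrV R n)))//.
  exact: measurable_consrV.
move=> mc; rewrite ge0_integral_pushforward//.
exact: measurableT_comp.
Qed.

(** The measure on R^(n+1) is by construction the image of a product measure,
    which opens the way to Fubini's theorem. *)
Lemma integral_consrV n (u : borel_rV n.+1 -> \bar R) :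
  (lebesgue_rV n.+1).-integrable setT u ->
  (\int[lebesgue_rV n.+1]_x u x =
   \int[lebesgue_measure \x lebesgue_rV n]_z u (consrV z))%E.
Proof.
move=> iu; rewrite (@eq_measure_integral _ _ _ _
    (pushforward (lebesgue_measure \x lebesgue_rV n)%E (@consrV R n)))//.
  exact: measurable_consrV.
move=> mc; rewrite integral_pushforward//.
- exact: measurable_int iu.
- exact: integrable_consrV.
Qed.

Lemma consrV_shift0 n t (x : 'rV[R]_n) (h : R) :
  h *: delta_mx ord0 ord0 + consrV (t, x : borel_rV n) =
  consrV (h + t, x : borel_rV n) :> 'rV[R]_n.+1.
Proof.
apply/rowP => j; rewrite !mxE eqxx /=.
by case: unliftP => [k ->|->] /=; rewrite ?eqxx /= ?mulr0 ?add0r// mulr1.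
Qed.

Lemma consrV_shiftS n t (x : 'rV[R]_n) (h : R) (i : 'I_n) :
  h *: delta_mx ord0 (lift ord0 i) + consrV (t, x : borel_rV n) =
  consrV (t, (h *: delta_mx ord0 i + x) : borel_rV n) :> 'rV[R]_n.+1.
Proof.
apply/rowP => j; rewrite !mxE eqxx /=.
case: unliftP => [k ->|->] /=; rewrite ?mulr0 ?add0r// !mxE eqxx /=.
by rewrite (inj_eq lift_inj).
Qed.

Lemma continuous_consrV1 n (x : 'rV[R]_n) :
  continuous (fun t => consrV (t, x : borel_rV n) : 'rV[R]_n.+1).
Proof.
move=> t; rewrite (_ : (fun t => _) = fun t : R =>
    t *: (delta_mx ord0 ord0 : 'rV[R]_n.+1) +
    consrV (0, x : borel_rV n)); last first.
  by apply/funext => s; rewrite consrV_shift0 addr0.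
by apply: cvgD; [exact: scalel_continuous|exact: cvg_cst].
Qed.

Lemma continuous_consrV2 n (t : R) :
  continuous (fun x : 'rV[R]_n => consrV (t, x : borel_rV n) : 'rV[R]_n.+1).
Proof.
move=> x; apply/cvg_ballP; [exact: nbhs_filter|move=> e e0; near=> y].
split=> // i j; rewrite ord1 !mxE; case: unliftP => [k|] _ /=.
  have : ball x e y by near: y; exact: (@nbhsx_ballx R _ x e e0).
  by case.
exact: ballxx.
Unshelve. all: by end_near. Qed.

Lemma integral_derive_R (g g' : R -> R) (B : R) :
  (forall t : R, is_derive t 1 g (g' t)) -> continuous g' ->
  (forall t, B < `|t| -> g t = 0) -> (forall t, B < `|t| -> g' t = 0) ->
  (\int[lebesgue_measure]_t (g' t)%:E = 0)%E.
Proof.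
move=> dg cg' g0 g'0.
have [C [BC C0]] : exists C : R, B < C /\ 0 < C.
  exists (`|B| + 1); split; last by rewrite ltr_wpDl.
  by rewrite (le_lt_trans (ler_norm _))// ltrDl.
have cg : continuous g by move=> t; exact: is_derive_continuous (dg t).
transitivity (\int[lebesgue_measure]_(t in `[(- C)%R, C]) (g' t)%:E)%E.
  rewrite [RHS]integral_mkcond; apply: eq_integral => t _; rewrite patchE.
  case: ifPn => //; rewrite notin_setE /= in_itv /= => /negP.
  by rewrite -ler_norml -ltNge => /(lt_trans BC) /g'0 ->.
rewrite (@continuous_FTC2 _ _ g).
- have -> : g C = 0 by apply: g0; rewrite gtr0_norm.
  have -> : g (- C) = 0 by apply: g0; rewrite normrN gtr0_norm.
  by rewrite sube0.
- by rewrite gtrN.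
- exact: continuous_subspaceT.
- split.
  + by move=> t _; case: (dg t).
  + by apply: cvg_at_right_filter; exact: cg.
  + by apply: cvg_at_left_filter; exact: cg.
- by move=> t _; rewrite derive1E; case: (dg t).
Qed.

(** The divergence theorem without boundary, one coordinate at a time.  By
    Fubini the integral is iterated over the first coordinate and the others:
    if the derivative is taken in the first coordinate, the inner integral is
    that of a compactly supported derivative on the line; otherwise it vanishes
    by induction on the dimension. *)
Lemma integral_derive_rV n (i : 'I_n) (g g' : 'rV[R]_n -> R) (B : R) :
  (forall x, is_derive x (delta_mx ord0 i) g (g' x)) -> continuous g' ->
  vanishes_off B g -> vanishes_off B g' ->
  (\int[lebesgue_rV n]_x (g' x)%:E = 0)%E.
Proof.
elim: n i g g' => [[]//|n IH] i g g' dg cg' vg vg'.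
have ig' := integrable_continuous_rV cg' vg'.
rewrite (integral_consrV ig').
have ic := integrable_consrV ig'.
case: (unliftP ord0 i) => [j|] ij; subst i.
- rewrite -integral12_prod_meas1//; apply: integral0_eq => t _ /=.
  apply: (IH j (fun x => g (consrV (t, x : borel_rV n)))
               (fun x => g' (consrV (t, x : borel_rV n)))).
  + move=> x; apply/is_derive_line.
    have /is_derive_line := dg (consrV (t, x : borel_rV n)).
    by under eq_fun do rewrite consrV_shiftS.
  + move=> x; apply: continuous_comp; first exact: continuous_consrV2.
    exact: cg'.
  + by move=> x k xk; apply: (vg _ (lift ord0 k)); rewrite consrVS.
  + by move=> x k xk; apply: (vg' _ (lift ord0 k)); rewrite consrVS.
- rewrite -integral21_prod_meas1//; apply: integral0_eq => x _ /=.
  apply: (@integral_derive_R (fun t => g (consrV (t, x : borel_rV n))) _ B).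
  + move=> t; apply/is_derive_line.
    have /is_derive_line := dg (consrV (t, x : borel_rV n)).
    under eq_fun do rewrite consrV_shift0.
    by under [in X in _ -> X]eq_fun do rewrite [_ *: _]mulr1.
  + move=> t; apply: continuous_comp; first exact: continuous_consrV1.
    exact: cg'.
  + by move=> t xk; apply: (vg _ ord0); rewrite consrV0.
  + by move=> t xk; apply: (vg' _ ord0); rewrite consrV0.
Qed.

End IntegralRn.

(** * The p-th power of the modulus *)

Section PowerOfModulus.
Context {R : realType}.

(** The absolute value matters: for [a < 0] and any [r] the convention
    [ln a = 0] gives [a `^ r = 1], so that the power alone jumps at [0]. *)
Lemma continuous_norm_powR (r : R) :
  0 < r -> continuous (fun a : R => `|a| `^ r).
Proof.
move=> r0 a; have [->{a}|a0] := eqVneq a 0.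
  rewrite /continuous_at normr0 powR0 ?gt_eqF//.
  apply/cvgr0Pnorm_lt => e e0; near=> b.
  rewrite ger0_norm ?powR_ge0//.
  rewrite -[ltRHS](@powRr1 _ e) ?ltW// -(@mulVf _ r) ?gt_eqF// powRrM.
  rewrite gt0_ltr_powR// ?nnegrE ?powR_ge0//.
  have : `|0 - b| < e `^ r^-1.
    near: b; apply: (@cvgr_dist_lt _ _ _ _ _ id 0); first exact: cvg_id.
    exact: powR_gt0.
  by rewrite sub0r normrN.
apply: (@continuous_comp _ _ _ (fun a : R => `|a|) (fun b => b `^ r)).
  exact: norm_continuous.
apply: is_derive_continuous; apply: is_derive1_powR.
by rewrite normr_gt0.
Unshelve. all: by end_near. Qed.

Lemma sqr_sum_eq0 (a b : R) : (a ^+ 2 + b ^+ 2 == 0) = (a == 0) && (b == 0).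
Proof. by rewrite paddr_eq0 ?sqr_ge0// !sqrf_eq0. Qed.

Lemma sqr_sum_ge0 (a b : R) : 0 <= a ^+ 2 + b ^+ 2.
Proof. by rewrite addr_ge0 ?sqr_ge0. Qed.

Lemma sqr_sum_gt0 (a b : R) : a ^+ 2 + b ^+ 2 != 0 -> 0 < a ^+ 2 + b ^+ 2.
Proof. by move=> ab; rewrite lt_neqAle eq_sym ab sqr_sum_ge0. Qed.

Lemma sqrt_sqr_sum_le (a b : R) : Num.sqrt (a ^+ 2 + b ^+ 2) <= `|a| + `|b|.
Proof.
rewrite -[leRHS]ger0_norm ?addr_ge0// -sqrtr_sqr ler_sqrt ?sqr_ge0//.
rewrite sqrrD !real_normK ?num_real// lerD2r lerDl.
by rewrite mulrn_wge0// mulr_ge0.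
Qed.

Variables (V : normedModType R) (q : R).
Hypothesis q_gt : 2^-1 < q.

Let q2 : 0 < q - 2^-1. Proof. by rewrite subr_gt0. Qed.

(** The squared modulus [a^2 + b^2] is raised to [q = p / 2], which gives the
    p-th power of the modulus of [a + i b].  Where it vanishes, the chain rule
    does not apply; but there [a] and [b] are [O(t)], so the power [2 q > 1] of
    the modulus is [o(t)].  The formula is valid at these points too, since the
    last factor is then [0] whatever the value of the power. *)
Lemma is_derive_modulus_powR (a b : V -> R) (x v : V) (da db : R) :
  is_derive x v a da -> is_derive x v b db ->
  is_derive x v (fun y => (a y ^+ 2 + b y ^+ 2) `^ q)
    (2 * q * (a x ^+ 2 + b x ^+ 2) `^ (q - 1) * (a x * da + b x * db)).
Proof.
move=> Da Db.
have Dm : is_derive x v (fun y => a y ^+ 2 + b y ^+ 2)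
    (2 * (a x * da + b x * db)).
  have := is_deriveD_fun (is_deriveM_fun Da Da) (is_deriveM_fun Db Db).
  by move/is_derive_eq; apply; ring.
have [m0|m0] := eqVneq (a x ^+ 2 + b x ^+ 2) 0; last first.
  have := is_derive_chain Dm (is_derive1_powR q (sqr_sum_gt0 m0)).
  by move/is_derive_eq; apply; ring.
have /andP[/eqP ax0 /eqP bx0] : (a x == 0) && (b x == 0).
  by rewrite -sqr_sum_eq0 m0.
rewrite [X in is_derive _ _ _ X](_ : _ = 0); last first.
  by rewrite ax0 bx0 !mul0r addr0 mulr0.
have slope (c : V -> R) dc : c x = 0 -> is_derive x v c dc ->
    `|t^-1 * c (t *: v + x)| @[t --> 0^'] --> `|dc|.
  move=> c0 [dc1 <-]; apply: cvg_norm.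
  have := dc1; rewrite /derivable => /cvg_lim; rewrite /derive.
  move: dc1; rewrite /derivable /=.
  by under eq_fun do rewrite c0 subr0.
pose m (t : R) : R := `|a (t *: v + x) ^+ 2 + b (t *: v + x) ^+ 2|.
apply: (@is_derive0_small _ _ _ _ _
  (fun t => (`|t^-1 * a (t *: v + x)| + `|t^-1 * b (t *: v + x)|) *
            m t `^ (q - 2^-1))).
- by rewrite m0 powR0// gt_eqF// (lt_trans _ q_gt).
- move=> t t0; rewrite ger0_norm ?powR_ge0// /m.
  set A := a _; set B := b _; rewrite (ger0_norm (sqr_sum_ge0 _ _)).
  have -> : (A ^+ 2 + B ^+ 2) `^ q =
      (A ^+ 2 + B ^+ 2) `^ 2^-1 * (A ^+ 2 + B ^+ 2) `^ (q - 2^-1).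
    by rewrite -powRD (addrC 2^-1) subrK// gt_eqF// (lt_trans _ q_gt).
  rewrite mulrA ler_wpM2r ?powR_ge0// powR12_sqrt ?sqr_sum_ge0//.
  rewrite (le_trans (sqrt_sqr_sum_le _ _))// !normrM -mulrDr mulrA normfV.
  by rewrite divff ?mul1r// normr_eq0.
- rewrite -[X in _ --> X](mulr0 (`|da| + `|db|)).
  apply: cvgM; first exact: (cvgD (slope _ _ ax0 Da) (slope _ _ bx0 Db)).
  have Dm0 : is_derive (0 : R) 1
    (fun t => a (t *: v + x) ^+ 2 + b (t *: v + x) ^+ 2)
    (2 * (a x * da + b x * db)) by exact: (is_derive_line _ _ _ _).1 Dm.
  have cm := is_derive_continuous Dm0.
  apply: cvg_within_filter.
  have := @continuous_comp _ _ _ _ (fun c : R => `|c| `^ (q - 2^-1)) _ cm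
    (@continuous_norm_powR _ q2 _).
  by rewrite /prop_for /continuous_at /= scale0r add0r m0 normr0 powR0// gt_eqF.
Unshelve. all: by end_near. Qed.

Lemma modulus_powR_le (a b : R) :
  (a ^+ 2 + b ^+ 2) `^ (q - 1) * `|a| <= `|a ^+ 2 + b ^+ 2| `^ (q - 2^-1).
Proof.
have [m0|m0] := eqVneq (a ^+ 2 + b ^+ 2) 0.
  have /andP[/eqP -> _] : (a == 0) && (b == 0) by rewrite -sqr_sum_eq0 m0.
  by rewrite normr0 mulr0 powR_ge0.
rewrite (ger0_norm (sqr_sum_ge0 _ _)).
rewrite (_ : q - 2^-1 = q - 1 + 2^-1); last by field.
rewrite [leRHS]powRD; last by rewrite m0 implybT.
rewrite ler_wpM2l ?powR_ge0// powR12_sqrt ?sqr_sum_ge0//.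
by rewrite -sqrtr_sqr ler_sqrt ?sqr_sum_ge0// lerDl sqr_ge0.
Qed.

(** Near a zero of the modulus the exponent [q - 1] may be negative; the factors
    [a] and [b] compensate for it by [modulus_powR_le], because
    [q - 1 + 1/2 > 0]. *)
Lemma continuous_modulus_powR_derive (a b da db : V -> R) :
  continuous a -> continuous b -> continuous da -> continuous db ->
  continuous (fun x => 2 * q * (a x ^+ 2 + b x ^+ 2) `^ (q - 1) *
                       (a x * da x + b x * db x)).
Proof.
move=> ca cb cda cdb x.
have cm : {for x, continuous (fun y => a y ^+ 2 + b y ^+ 2)}.
  by apply: cvgD; apply: cvgM; [exact: ca|exact: ca|exact: cb|exact: cb].
have [m0|m0] := eqVneq (a x ^+ 2 + b x ^+ 2) 0; last first.
  apply: cvgM.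
    apply: cvgM; first exact: cvg_cst.
    apply: (@continuous_comp _ _ _ _ (fun c : R => c `^ (q - 1)) _ cm).
    exact: (is_derive_continuous (is_derive1_powR _ (sqr_sum_gt0 m0))).
  by apply: cvgD; apply: cvgM; [exact: ca|exact: cda|exact: cb|exact: cdb].
have /andP[/eqP ax0 /eqP bx0] : (a x == 0) && (b x == 0).
  by rewrite -sqr_sum_eq0 m0.
rewrite /continuous_at ax0 bx0 !mul0r addr0 mulr0.
apply/norm_cvg0P.
have e0 : `|2 * q| * (`|a y ^+ 2 + b y ^+ 2| `^ (q - 2^-1) *
    (`|da y| + `|db y|)) @[y --> x] --> (0 : R).
  rewrite -[X in _ --> X](mulr0 `|2 * q|).
  apply: cvgM; first exact: cvg_cst.
  rewrite -[X in _ --> X](mul0r (`|da x| + `|db x|)).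
  apply: cvgM; last first.
    by apply: cvgD; apply: cvg_norm; [exact: cda|exact: cdb].
  have := @continuous_comp _ _ _ _ (fun c : R => `|c| `^ (q - 2^-1)) _ cm
    (@continuous_norm_powR _ q2 _).
  by rewrite /prop_for /continuous_at /= m0 normr0 powR0// gt_eqF.
apply: (squeeze_cvgr _ (cvg_cst 0) e0); near=> y.
rewrite normr_ge0 /= !normrM -mulrA ler_wpM2l ?mulr_ge0//.
rewrite (ger0_norm (powR_ge0 _ _)).
rewrite (le_trans (ler_wpM2l (powR_ge0 _ _) (ler_normD _ _)))//.
rewrite !normrM !mulrDr lerD// mulrA ler_wpM2r// ?modulus_powR_le//.
by rewrite addrC modulus_powR_le.
Unshelve. all: by end_near. Qed.

End PowerOfModulus.

(** * The pointwise inequality *)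

Section PointwiseHardy.
Context {R : realType}.

(** Lagrange's identity: twice the defect is the sum of the squares of the
    minors [a i * b j - a j * b i]. *)
Lemma cauchy_schwarz_sum n (a b : 'I_n -> R) :
  (\sum_i a i * b i) ^+ 2 <= (\sum_i a i ^+ 2) * (\sum_i b i ^+ 2).
Proof.
have H : 0 <= \sum_i \sum_j (a i * b j - a j * b i) ^+ 2.
  by apply: sumr_ge0 => i _; apply: sumr_ge0 => j _; exact: sqr_ge0.
have E : \sum_i \sum_j (a i * b j - a j * b i) ^+ 2 =
    \sum_i \sum_j a i ^+ 2 * b j ^+ 2 + \sum_i \sum_j b i ^+ 2 * a j ^+ 2
    - 2 * \sum_i \sum_j (a i * b i) * (a j * b j).
  rewrite mulr_sumr -sumrN -!big_split; apply: eq_bigr => i _ /=.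
  rewrite mulr_sumr -sumrN -!big_split; apply: eq_bigr => j _ /=; ring.
rewrite E -!big_distrlr /= in H.
by rewrite -expr2 in H; lra.
Qed.

(** Young's inequality with exponents [p/(p-1)] and [p], and the weight for
    which it is an equality when [h = C d].  A weight fixed in advance lets the
    estimate be integrated as it stands, without Hoelder's inequality. *)
Lemma young_weighted (C p h d : R) : 0 < C -> 1 < p -> 0 <= h -> 0 <= d ->
  p * (h `^ (p - 1) * d) <= (p - 1) / C * h `^ p + C `^ (p - 1) * d `^ p.
Proof.
move=> C0; rewrite -subr_gt0 => p1 h0 d0.
have p0 : 0 < p by rewrite (lt_trans ltr01)// -subr_gt0.
have pn0 : p != 0 by rewrite gt_eqF.
have p1n0 : p - 1 != 0 by rewrite gt_eqF.
have := @conjugate_powR R (C `^ ((p - 1) / p) * d)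
  (C `^ (- ((p - 1) / p)) * h `^ (p - 1)) p (p / (p - 1)).
rewrite !mulr_ge0 ?powR_ge0// divr_gt0// p0.
have -> : p^-1 + (p / (p - 1))^-1 = 1 by rewrite invf_div; field.
move=> /(_ isT isT isT isT erefl).
rewrite !powRM ?powR_ge0// -!powRrM.
have -> : (p - 1) / p * p = p - 1 by field.
have -> : - ((p - 1) / p) * (p / (p - 1)) = -1.
  by field; rewrite pn0 p1n0.
have -> : (p - 1) * (p / (p - 1)) = p by field.
rewrite (powR_inv1 (ltW C0)) mulrACA -powRD; last first.
  by rewrite (gt_eqF C0) implybT.
rewrite subrr powRr0 mul1r (mulrC d) => H.
have -> : (p - 1) / C * h `^ p + C `^ (p - 1) * d `^ p =
  p * (C `^ (p - 1) * d `^ p / p + C^-1 * h `^ p / (p / (p - 1))).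
  by field; rewrite (gt_eqF C0) pn0 p1n0.
by rewrite ler_pM2l.
Qed.

(** The i-th summand is the derivative in [X i] of [|f|^p X i |X|^(-p)], where
    [f = u + i w], with the squared moduli [m = |f|^2] and [s = |X|^2].  The
    terms in which the weight is differentiated add up to [(N - p) (|f|/|X|)^p],
    and the others are at least [- p (|f|/|X|)^(p-1) d] by Cauchy-Schwarz; then
    [young_weighted] absorbs all but [1 / C] of the former, because
    [N - p - (p - 1) / C = 1 / C]. *)
Lemma pointwise_hardy N (C p : R) (X du dw : 'I_N -> R) (u w d : R) :
  let q := p / 2 in
  let s := \sum_i X i ^+ 2 in
  let m := u ^+ 2 + w ^+ 2 in
  0 < C -> 1 < p -> C * (N%:R - p) = p -> 0 < s -> 0 <= d ->
  \sum_i (du i ^+ 2 + dw i ^+ 2) <= d ^+ 2 ->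
  C^-1 * (Num.sqrt m / Num.sqrt s) `^ p <=
  \sum_i (2 * q * m `^ (q - 1) * (u * du i + w * dw i) * (X i * s `^ (- q)) +
          m `^ q * (s `^ (- q) + X i * (- q * s `^ (- q - 1) * (2 * X i))))
  + C `^ (p - 1) * d `^ p.
Proof.
move=> q s m C0 p1 CE s0 d0 dd.
have p0 : 0 < p by rewrite (lt_trans ltr01).
have m0 : 0 <= m by exact: sqr_sum_ge0.
pose T := \sum_i X i * (u * du i + w * dw i).
have TE : `|T| <= Num.sqrt s * Num.sqrt m * d.
  rewrite -[leRHS]ger0_norm ?mulr_ge0// -ler_sqr ?nnegrE ?normr_ge0//.
  rewrite !real_normK ?num_real// !exprMn (sqr_sqrtr (ltW s0)) (sqr_sqrtr m0).
  rewrite (le_trans (cauchy_schwarz_sum _ _))// -/s -mulrA.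
  rewrite ler_wpM2l ?(ltW s0)//.
  apply: (@le_trans _ _ (m * \sum_i (du i ^+ 2 + dw i ^+ 2))).
    rewrite mulr_sumr ler_sum// => i _; rewrite /m -subr_ge0.
    rewrite (_ : _ - _ = (u * dw i - w * du i) ^+ 2) ?sqr_ge0//; ring.
  by rewrite ler_wpM2l.
rewrite [X in _ <= X + _](_ : _ = p * (m `^ (q - 1) * s `^ (- q) * T) +
    (N%:R - p) * (m `^ q * s `^ (- q))); last first.
  rewrite big_split /=; congr (_ + _).
    rewrite /T !mulr_sumr; apply: eq_bigr => i _; by rewrite /q; field.
  rewrite -mulr_sumr big_split /= sumr_const card_ord.
  rewrite (_ : \sum_i X i * _ = - q * 2 * (s `^ (- q - 1) * s)); last first.
    by rewrite /s !mulr_sumr; apply: eq_bigr => i _; ring.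
  rewrite [s `^ (- q - 1) * s]mulrC.
  have -> : s * s `^ (- q - 1) = s `^ (- q).
    rewrite -[X in X * _](@powRr1 _ s) ?(ltW s0)// -powRD; last first.
      by rewrite (gt_eqF s0) implybT.
    by congr (_ `^ _); ring.
  by rewrite -mulr_natr /q; field.
have [m00|mn0] := eqVneq m 0.
  have -> : T = 0.
    apply/eqP; rewrite -normr_le0 (le_trans TE)// m00 sqrtr0.
    by rewrite mulr0 mul0r.
  rewrite m00 sqrtr0 mul0r (@powR0 _ p) ?gt_eqF//.
  rewrite (@powR0 _ q) ?gt_eqF ?divr_gt0// mul0r.
  by rewrite !mulr0 !add0r mulr_ge0// powR_ge0.
have {}m0 : 0 < m by rewrite lt_neqAle eq_sym mn0.
pose h := Num.sqrt m / Num.sqrt s.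
have h0 : 0 <= h by rewrite divr_ge0.
have hE r : h `^ r = m `^ (r / 2) * s `^ (- (r / 2)).
  rewrite /h powRM// ?invr_ge0// -!powR12_sqrt ?ltW// -powRN -!powRrM.
  by congr (_ `^ _ * _ `^ _); ring.
have := young_weighted C0 p1 h0 d0.
have -> : m `^ q * s `^ (- q) = h `^ p by rewrite hE.
have T2 : - (h `^ (p - 1) * d) <= m `^ (q - 1) * s `^ (- q) * T.
  have : `|m `^ (q - 1) * s `^ (- q) * T| <= h `^ (p - 1) * d.
    rewrite normrM ger0_norm ?mulr_ge0 ?powR_ge0//.
    apply: (le_trans (ler_wpM2l _ TE)); first by rewrite mulr_ge0 ?powR_ge0.
    rewrite !mulrA ler_wpM2r// hE.
    rewrite -(powR12_sqrt (ltW s0)) -(powR12_sqrt (ltW m0)).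
    rewrite [leLHS](_ : _ = (m `^ (q - 1) * m `^ 2^-1) *
        (s `^ (- q) * s `^ 2^-1)); last by ring.
    rewrite -!powRD ?(gt_eqF s0) ?(gt_eqF m0) ?implybT//.
    by rewrite le_eqVlt; apply/orP; left; apply/eqP; congr (_ `^ _ * _ `^ _);
      rewrite /q; field.
  by rewrite ler_norml => /andP[].
move: T2; rewrite -/h.
set A := _ * T; set Hp := h `^ p; set K := h `^ (p - 1) * d.
set Dp := _ * d `^ p => T2 Y.
have NE : N%:R - p = p / C.
  by rewrite -[X in X / C]CE mulrAC divff ?mul1r// gt_eqF.
have := ler_wpM2l (ltW p0) T2; rewrite NE.
move: Y; have -> : (p - 1) / C * Hp = p / C * Hp - C^-1 * Hp by ring.
lra.
Qed.

End PointwiseHardy.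

(** * Hardy's inequality for test functions *)

Section Hardy.
Context {R : realType} {n : nat}.

Lemma normcE (z : R[i]) :
  Normc.normc z = Num.sqrt (complex.Re z ^+ 2 + complex.Im z ^+ 2).
Proof. by case: z. Qed.

Lemma LpRnE (p : R) (g : 'rV[R]_n -> R) : LpRn p g =
  ((\int[lebesgue_rV n]_x (`|g x| `^ p)%:E) `^ p^-1)%E.
Proof. by rewrite /LpRn unlock. Qed.

Lemma le_LpRn (p C : R) (g h : 'rV[R]_n -> R) : 0 < p -> 0 <= C ->
  (\int[lebesgue_rV n]_x (`|g x| `^ p)%:E <=
   (C `^ p)%:E * \int[lebesgue_rV n]_x (`|h x| `^ p)%:E)%E ->
  (LpRn p g <= C%:E * LpRn p h)%E.
Proof.
move=> p0 C0 gh; rewrite !LpRnE.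
have I0 (k : 'rV[R]_n -> R) :
    (0 <= \int[lebesgue_rV n]_x (`|k x| `^ p)%:E)%E.
  by apply: integral_ge0 => x _; rewrite lee_fin powR_ge0.
have -> : C%:E = ((C `^ p)%:E `^ p^-1)%E.
  by rewrite poweR_EFin -powRrM divff ?powRr1// gt_eqF.
rewrite -poweRM ?lee_fin ?powR_ge0//.
apply: gt0_ler_poweR => //.
- by rewrite invr_ge0 ltW.
- by rewrite in_itv /= I0 leey.
- by rewrite in_itv /= mule_ge0 ?leey// lee_fin powR_ge0.
Qed.

Definition sqsum (P : pred 'I_n) (x : 'rV[R]_n) : R :=
  \sum_(i < n | P i) x ord0 i ^+ 2.

Lemma sqsum_ge0 P x : 0 <= sqsum P x.
Proof. by apply: sumr_ge0 => i _; exact: sqr_ge0. Qed.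

Lemma Ck_sqsum P k : Ck k (sqsum P).
Proof. by apply: Ck_sum => j; apply: Ck_mul; exact: Ck_coord. Qed.

Lemma is_derive_sqsum P (i : 'I_n) (x : 'rV[R]_n) :
  is_derive x (delta_mx ord0 i) (sqsum P) (2 * x ord0 i * (P i)%:R).
Proof.
have H (j : 'I_n) := is_deriveM_fun (is_deriveM_fun (is_derive_coord j i x)
  (is_derive_coord j i x)) (is_derive_cst ((P j)%:R : R) x (delta_mx ord0 i)).
have := is_derive_sum H.
rewrite (_ : \sum_(j < n) _ = sqsum P); last first.
  apply/funext => y; rewrite fct_sumE /sqsum [RHS]big_mkcond /=.
  by apply: eq_bigr => j _; case: (P j); rewrite ?mulr1 ?mulr0.
move/is_derive_eq; apply; rewrite (bigD1 i)//= big1 ?addr0 => [|j ji].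
  by rewrite eqxx /= mul1r mulr1 mulr0 addr0 -mulr2n mulr_natl.
by rewrite (negbTE ji) /= !mul0r !mulr0 !addr0 mul0r.
Qed.

Definition sqnorm_fst N : 'rV[R]_n -> R := sqsum (fun i => (i < N)%N).

Section SquaredNorm.
Variables (N : nat) (leNn : (N <= n)%N).

Lemma sqnorm_fstE (x : 'rV[R]_n) :
  sqnorm_fst N x = \sum_(i < N) x ord0 (widen_ord leNn i) ^+ 2.
Proof. exact: (big_ord_narrow leNn). Qed.

Lemma enorm_fst_coords (x : 'rV[R]_n) :
  enorm (fst_coords leNn x) = Num.sqrt (sqnorm_fst N x).
Proof.
by rewrite sqnorm_fstE; congr Num.sqrt; apply: eq_bigr => i _; rewrite mxE.
Qed.

Lemma sqnorm_fst_gt0 x : fst_coords leNn x <> 0 -> 0 < sqnorm_fst N x.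
Proof.
move=> x0; rewrite lt_neqAle sqsum_ge0 andbT eq_sym; apply/eqP.
rewrite sqnorm_fstE => s0; apply: x0; apply/rowP => i; rewrite !mxE.
by apply/eqP; rewrite -sqrf_eq0 (psumr_eq0P _ s0)// => j _; exact: sqr_ge0.
Qed.

End SquaredNorm.

Section Support.
Variable f : 'rV[R]_n -> R[i].

Lemma near_notin_csupport x :
  ~ csupport f x -> \forall y \near x, ~ csupport f y.
Proof.
move=> xS; have : open (~` csupport f) by exact/closed_openC/closed_closure.
by rewrite openE => /(_ x xS).
Qed.

Lemma notin_csupport x : ~ csupport f x -> f x = 0.
Proof. by apply: contra_notP => /eqP fy; exact: subset_closure. Qed.

Lemma partial_notin_csupport (h : R[i] -> R) (i : 'I_n) x : h 0 = 0 ->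
  ~ csupport f x -> partial i (fun y => h (f y)) x = 0.
Proof.
move=> h0 /near_notin_csupport xS; rewrite /partial.
rewrite (@near_eq_derive _ _ _ _ (cst 0)) ?derive_cst//.
by apply: filterS xS => y /notin_csupport ->; rewrite h0.
Qed.

Lemma csupport_bounded : compact (csupport f) ->
  exists B : R, forall (x : 'rV[R]_n) i, B < `|x ord0 i| -> ~ csupport f x.
Proof.
move=> /compact_bounded[M [Mr HM]]; exists (`|M| + 1) => x i xi xS.
have : `|x| <= `|M| + 1.
  by apply: (HM (`|M| + 1)) xS; rewrite (le_lt_trans (ler_norm _))// ltrDl.
apply/negP; rewrite -ltNge (lt_le_trans xi)//.
rewrite [leRHS]/Num.norm /= mx_normrE.
by apply/bigmax_geP; right; exists (ord0, i).
Qed.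

(** A function built from [f] and from weights singular on the complement of [P]
    is continuous everywhere, since it vanishes near each point off the
    support. *)
Lemma continuous_off_csupport (P : set 'rV[R]_n) (k : 'rV[R]_n -> R) :
  (forall x, csupport f x -> P x) ->
  (forall x, P x -> {for x, continuous k}) ->
  (forall x, ~ csupport f x -> k x = 0) -> continuous k.
Proof.
move=> SP kP k0 x; have [/SP/kP//|xS] := pselect (csupport f x).
have E : \forall y \near x, cst 0 y = k y.
  by move: (near_notin_csupport xS); apply: filterS => y /k0 ->.
rewrite /continuous_at (k0 _ xS).
exact: (cvg_trans (near_eq_cvg E) (cvg_cst 0)).
Qed.

End Support.

Lemma cenorm_cgrad_sqr (f : 'rV[R]_n -> R[i]) x : cenorm (cgrad f x) ^+ 2 =
  \sum_i (partial i (fun y => complex.Re (f y)) x ^+ 2 +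
          partial i (fun y => complex.Im (f y)) x ^+ 2).
Proof.
rewrite /cenorm sqr_sqrtr; last by apply: sumr_ge0 => i _; exact: sqr_ge0.
by apply: eq_bigr => i _; rewrite mxE normcE sqr_sqrtr ?sqr_sum_ge0.
Qed.

Lemma continuous_cenorm_cgrad (f : 'rV[R]_n -> R[i]) : csmooth f ->
  continuous (fun x => cenorm (cgrad f x)).
Proof.
move=> /(_ 1)[[_ Cu] [_ Cw]].
have cd2 : Ck 0 (fun x : 'rV[R]_n => \sum_(i < n)
    (partial i (fun y => complex.Re (f y)) x ^+ 2 +
     partial i (fun y => complex.Im (f y)) x ^+ 2)).
  apply: Ck_sum => j; have [_ cu] := Cu j; have [_ cw] := Cw j.
  have sq (g : 'rV[R]_n -> R) : Ck 0 g -> Ck 0 (fun x => g x ^+ 2).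
    by move=> Cg; exact: (Ck_mul Cg Cg).
  exact: (Ck_add (sq _ cu) (sq _ cw)).
have -> : (fun x => cenorm (cgrad f x)) = Num.sqrt \o (fun x => \sum_(i < n)
    (partial i (fun y => complex.Re (f y)) x ^+ 2 +
     partial i (fun y => complex.Im (f y)) x ^+ 2)).
  apply/funext => x /=; rewrite -cenorm_cgrad_sqr sqrtr_sqr ger0_norm//.
  exact: sqrtr_ge0.
move=> x; apply: continuous_comp; first exact: (Ck_continuous cd2).
exact: sqrt_continuous.
Qed.

Section Inequality.
Variables (N : nat) (leNn : (N <= n)%N) (p : R) (f : 'rV[R]_n -> R[i]).
Hypothesis hp : 1 < p < N%:R.
Hypothesis ft : test_fun [set x : 'rV[R]_n | fst_coords leNn x <> 0] f.

Let C := p / (N%:R - p).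
Let q := p / 2.
Let u x := complex.Re (f x).
Let w x := complex.Im (f x).
Let s := sqnorm_fst N.
Let X (i : 'I_N) (x : 'rV[R]_n) : R := x ord0 (widen_ord leNn i).
Let m x := u x ^+ 2 + w x ^+ 2.
Let W i x :=
  2 * q * m x `^ (q - 1) * (u x * partial i u x + w x * partial i w x).
(** The i-th component of the field [|f|^p x' / |x'|^p], whose divergence is
    the sum of the [dg i]. *)
Let g i x := m x `^ q * (X i x * s x `^ (- q)).
Let dg i x := W (widen_ord leNn i) x * (X i x * s x `^ (- q)) +
  m x `^ q * (s x `^ (- q) + X i x * (- q * s x `^ (- q - 1) * (2 * X i x))).
Let d x := cenorm (cgrad f x).

Let p1 : 1 < p. Proof. by case/andP: hp. Qed.
Let p0 : 0 < p. Proof. exact: lt_trans p1. Qed.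
Let q0 : 0 < q. Proof. by rewrite divr_gt0. Qed.
Let q_gt : 2^-1 < q. Proof. by rewrite /q -[ltLHS]mul1r ltr_pM2r. Qed.
Let C0 : 0 < C.
Proof. by rewrite divr_gt0// subr_gt0; case/andP: hp. Qed.
Let CE : C * (N%:R - p) = p.
Proof. by rewrite divfK// subr_eq0; case/andP: hp => _ /gt_eqF ->. Qed.

Let Cu k : Ck k u. Proof. by case: ft => /(_ k)[]. Qed.
Let Cw k : Ck k w. Proof. by case: ft => /(_ k)[]. Qed.
Let cu : continuous u. Proof. exact: Ck_continuous (Cu 0). Qed.
Let cw : continuous w. Proof. exact: Ck_continuous (Cw 0). Qed.
Let cdu i : continuous (partial i u).
Proof. by case: (Cu 1) => _ /(_ i)[]. Qed.
Let cdw i : continuous (partial i w).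
Proof. by case: (Cw 1) => _ /(_ i)[]. Qed.
Let cs : continuous s. Proof. exact: Ck_continuous (Ck_sqsum _ 0). Qed.
Let cm : continuous m.
Proof.
exact: (@Ck_continuous _ _ 0 m
  (Ck_add (Ck_mul (Cu 0) (Cu 0)) (Ck_mul (Cw 0) (Cw 0)))).
Qed.

Let s_gt0 x : csupport f x -> 0 < s x.
Proof. by case: ft => _ _ /(_ x) /[apply] /sqnorm_fst_gt0. Qed.

Let u0 x : ~ csupport f x -> u x = 0.
Proof. by move/notin_csupport; rewrite /u => ->. Qed.
Let w0 x : ~ csupport f x -> w x = 0.
Proof. by move/notin_csupport; rewrite /w => ->. Qed.
Let m0 x : ~ csupport f x -> m x = 0.
Proof. by move=> xS; rewrite /m u0// w0// expr0n addr0. Qed.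
Let mq0 x : ~ csupport f x -> m x `^ q = 0.
Proof. by move=> xS; rewrite m0// powR0// gt_eqF. Qed.
Let W0 i x : ~ csupport f x -> W i x = 0.
Proof. by move=> xS; rewrite /W u0// w0// !mul0r addr0 mulr0. Qed.
Let dg0 i x : ~ csupport f x -> dg i x = 0.
Proof. by move=> xS; rewrite /dg W0// mq0// !mul0r addr0. Qed.
Let d0 x : ~ csupport f x -> d x = 0.
Proof.
move=> xS; rewrite /d /cenorm big1 ?sqrtr0// => i _.
rewrite mxE normcE /= !partial_notin_csupport// expr0n addr0 sqrtr0.
by rewrite expr0n.
Qed.

Let is_derive_g i x :
  is_derive x (delta_mx ord0 (widen_ord leNn i)) (g i) (dg i x).
Proof.
have [/s_gt0 sx|xS] := pselect (csupport f x); last first.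
  rewrite dg0//; refine (@near_eq_is_derive _ _ _ (cst 0) _ _ _ _ _ _) => /=.
  by apply: filterS (near_notin_csupport xS) => y yS; rewrite /g mq0// mul0r.
have Dm := is_derive_modulus_powR q_gt (Ck_derive (widen_ord leNn i) x (Cu 1))
  (Ck_derive (widen_ord leNn i) x (Cw 1)).
have Ds := is_derive_chain
  (is_derive_sqsum (fun j => (j < N)%N) (widen_ord leNn i) x)
  (is_derive1_powR (- q) sx).
have := is_deriveM_fun Dm (is_deriveM_fun
  (is_derive_coord (widen_ord leNn i) (widen_ord leNn i) x) Ds).
by move/is_derive_eq; apply; rewrite eqxx mul1r /= ltn_ord mulr1.
Qed.

Let continuous_powR_s (r : R) x : 0 < s x ->
  {for x, continuous (fun y => s y `^ r)}.
Proof.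
move=> sx; apply: (@continuous_comp _ _ _ s (fun c : R => c `^ r)).
  exact: cs.
exact: (is_derive_continuous (is_derive1_powR _ sx)).
Qed.

Let continuous_dg i : continuous (dg i).
Proof.
apply: (continuous_off_csupport s_gt0) => [x sx|x]; last exact: dg0.
have cX : {for x, continuous (X i)} by exact: coord_continuous.
have cW := continuous_modulus_powR_derive q_gt cu cw
  (@cdu (widen_ord leNn i)) (@cdw (widen_ord leNn i)).
have cmq : {for x, continuous (fun y => m y `^ q)}.
  have := @continuous_comp _ _ _ m (fun c : R => `|c| `^ q) x (@cm x)
    (@continuous_norm_powR R q q0 (m x)).
  rewrite (_ : _ \o _ = (fun y => m y `^ q))//; apply/funext => y /=.
  by rewrite ger0_norm// sqr_sum_ge0.
have c1 := @continuous_powR_s (- q) x sx.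
have c2 := @continuous_powR_s (- q - 1) x sx.
have cc (c : R) : {for x, continuous (fun _ : 'rV[R]_n => c)}.
  exact: cst_continuous.
exact: (continuousD (continuousM (@cW x) (continuousM cX c1))
  (continuousM cmq (continuousD c1 (continuousM cX
    (continuousM (continuousM (cc (- q)) c2) (continuousM (cc 2) cX)))))).
Qed.

Let continuous_dp : continuous (fun x => d x `^ p).
Proof.
have cd : continuous d by apply: continuous_cenorm_cgrad; case: ft.
rewrite (_ : (fun x => d x `^ p) = (fun c : R => `|c| `^ p) \o d); last first.
  by apply/funext => x /=; rewrite ger0_norm ?sqrtr_ge0.
move=> x; apply: continuous_comp; first exact: cd.
exact: continuous_norm_powR.
Qed.

Let H x := Normc.normc (f x) / enorm (fst_coords leNn x).

Let HE x : H x = Num.sqrt (m x) / Num.sqrt (s x).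
Proof. by rewrite /H normcE enorm_fst_coords. Qed.

Let H_ge0 x : 0 <= H x. Proof. by rewrite HE divr_ge0. Qed.

Let pointwise x : C^-1 * H x `^ p <= \sum_i dg i x + C `^ (p - 1) * d x `^ p.
Proof.
rewrite HE; have [/s_gt0 sx|xS] := pselect (csupport f x).
  move: sx; rewrite /dg /s !(sqnorm_fstE leNn) => sx.
  apply: (@pointwise_hardy R N C p (X^~ x)
    (fun i => partial (widen_ord leNn i) u x)
    (fun i => partial (widen_ord leNn i) w x) (u x) (w x) (d x) C0 p1 CE sx).
    exact: sqrtr_ge0.
  rewrite cenorm_cgrad_sqr [leRHS](bigID (fun i : 'I_n => (i < N)%N)) /=.
  rewrite (big_ord_narrow leNn) lerDl.
  by apply: sumr_ge0 => i _; exact: sqr_sum_ge0.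
rewrite m0// sqrtr0 mul0r d0// powR0 ?gt_eqF// !mulr0 addr0.
by rewrite big1// => i _; rewrite dg0.
Qed.

Let measurable_Hp : measurable_fun setT
  (fun x : borel_rV n => H x `^ p : measurableTypeR R).
Proof.
apply: (@measurableT_comp _ _ _ _ _ _ (@powR R ^~ p)).
  exact: measurable_powR.
have -> : (H : borel_rV n -> measurableTypeR R) =
    (fun x => m x `^ 2^-1 * s x `^ (- 2^-1)).
  apply/funext => x; rewrite HE powRN !powR12_sqrt ?sqr_sum_ge0//.
  exact: sqsum_ge0.
apply: measurable_funM.
  apply: (@measurableT_comp _ _ _ _ _ _ (@powR R ^~ 2^-1)).
    exact: measurable_powR.
  exact: measurable_continuous_rV cm.
apply: (@measurableT_comp _ _ _ _ _ _ (@powR R ^~ (- 2^-1))).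
  exact: measurable_powR.
exact: measurable_continuous_rV cs.
Qed.

(** Integration of the pointwise inequality; the divergence contributes [0]. *)
Theorem hardy_inequality : (LpRn p H <= C%:E * LpRn p d)%E.
Proof.
apply: le_LpRn p0 (ltW C0) _.
under eq_integral do rewrite ger0_norm ?H_ge0//.
under [X in (_ <= _ * X)%E]eq_integral do rewrite ger0_norm ?sqrtr_ge0//.
have [B HB] : exists B : R, forall (x : 'rV[R]_n) i,
    B < `|x ord0 i| -> ~ csupport f x.
  by apply: csupport_bounded; case: ft.
have vdg i : vanishes_off B (dg i) by move=> x j /HB /dg0.
have vg i : vanishes_off B (g i) by move=> x j /HB /mq0 xS; rewrite /g xS mul0r.
have vd : vanishes_off B (fun x => d x `^ p).
  by move=> x j /HB /d0 ->; rewrite powR0// gt_eqF.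
have idg i := integrable_continuous_rV (@continuous_dg i) (vdg i).
have id := integrable_continuous_rV continuous_dp vd.
have idg0 : (\int[lebesgue_rV n]_x (\sum_(i < N) (dg i x)%:E) = 0)%E.
  rewrite integral_sum//.
  apply: big1 => i _.
  exact: integral_derive_rV (is_derive_g i) _ (vg i) (vdg i).
suff I : ((C^-1)%:E * \int[lebesgue_rV n]_x (H x `^ p)%:E <=
          (C `^ (p - 1))%:E * \int[lebesgue_rV n]_x (d x `^ p)%:E)%E.
  rewrite -(mulr_powRB1 (ltW C0) p0) EFinM -muleA -lee_pdivrMl//.
rewrite -ge0_integralZl_EFin ?invr_ge0 ?(ltW C0)//; last 2 first.
- by move=> x _; rewrite lee_fin powR_ge0.
- exact/measurable_EFinP.
rewrite -(integralZl measurableT id) -[leRHS]add0e -idg0.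
rewrite -integralD//; last 2 first.
- exact: integrable_sum.
- exact: integrableZl.
apply: ge0_le_integral => //.
- by move=> x _; rewrite -EFinM lee_fin mulr_ge0 ?powR_ge0// invr_ge0 ltW.
- by apply: measurable_funeM; exact/measurable_EFinP.
- apply: measurable_int; apply: integrableD => //.
    exact: integrable_sum.
  exact: integrableZl.
- by move=> x _; rewrite -!EFinM sumEFin -EFinD lee_fin.
Qed.

End Inequality.
End Hardy.

(** * The radial profile *)

Section RadialProfile.
Context {R : realType}.
Variables (a k : R).
Hypotheses (a0 : 0 <= a) (k1 : 1 <= k).

Let k0 : 0 < k. Proof. exact: lt_le_trans k1. Qed.

Lemma le_powRN (x y : R) : 0 < x -> x <= y -> y `^ (- a) <= x `^ (- a).
Proof.
move=> x0 xy; have y0 : 0 < y by exact: lt_le_trans xy.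
rewrite !powRN lef_pV2 ?posrE ?powR_gt0// ge0_ler_powR// ?nnegrE; exact: ltW.
Qed.

Lemma powRN_le1 (x : R) : 1 <= x -> x `^ (- a) <= 1.
Proof. by move=> x1; have := le_powRN ltr01 x1; rewrite powR1. Qed.

(** As a function of [t = |x'|^2] the profile behaves like the power
    [t^(- a) = |x'|^(-2a)] for [2 <= t <= k^2].  The shift to [1 + t] makes each
    factor smooth on [t >= 0], at no cost by [norm_profile_derive_le]. *)
Definition profile t : R :=
  (1 + t) `^ (- a) * (cutoff (t - 1) * cutoff (2 - t / k ^+ 2)).

Definition profile_derive t : R :=
  - a * (1 + t) `^ (- a - 1) * (cutoff (t - 1) * cutoff (2 - t / k ^+ 2)) +
  (1 + t) `^ (- a) * (cutoff_derive (t - 1) * cutoff (2 - t / k ^+ 2) -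
    cutoff (t - 1) * (cutoff_derive (2 - t / k ^+ 2) / k ^+ 2)).

(** The part of the gradient that comes from the two cutoffs. *)
Definition profile_error t : R :=
  2 * Num.sqrt t * (1 + t) `^ (- a) *
    (`|cutoff_derive (t - 1)| + `|cutoff_derive (2 - t / k ^+ 2)| / k ^+ 2).

Lemma is_derive_cutoff_affine (b c t : R) :
  is_derive t 1 (fun z => cutoff (b + c * z)) (cutoff_derive (b + c * t) * c).
Proof.
have H : is_derive t 1 (fun z : R => b + c * z) c.
  have := is_deriveD_fun (is_derive_cst b t 1)
    (is_deriveM_fun (is_derive_cst c t 1) (is_derive_id t 1)).
  by move/is_derive_eq; apply; rewrite mul0r !add0r mulr1.
exact: is_derive_chain H (is_derive_cutoff _).
Qed.

Lemma is_derive_profile (t : R) :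
  0 <= t -> is_derive t 1 profile (profile_derive t).
Proof.
move=> t0; have t1 : 0 < 1 + t by rewrite ltr_pwDl.
have H1 : is_derive t 1 (fun z : R => 1 + z) 1.
  have := is_deriveD_fun (is_derive_cst (1 : R) t 1) (is_derive_id t 1).
  by move/is_derive_eq; apply; rewrite add0r.
have H2 := is_derive_chain H1 (is_derive1_powR (- a) t1).
have H3 := is_derive_cutoff_affine (- 1) 1 t.
have H4 := is_derive_cutoff_affine 2 (- (k ^+ 2)^-1) t.
have := is_deriveM_fun H2 (is_deriveM_fun H3 H4).
have E1 (z : R) : -1 + 1 * z = z - 1 by ring.
have E2 (z : R) : 2 + - (k ^+ 2)^-1 * z = 2 - z / k ^+ 2 by ring.
rewrite (_ : (fun y => _) = profile); last first.
  by apply/funext => z; rewrite /profile E1 E2.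
move/is_derive_eq; apply; rewrite E1 E2 /profile_derive.
move: (_ `^ _) (_ `^ _) (cutoff (t - 1)) (cutoff (2 - t / k ^+ 2))
  (cutoff_derive (t - 1)) (cutoff_derive (2 - t / k ^+ 2)) => *; ring.
Qed.

Lemma profile_ge0 t : 0 <= profile t.
Proof. by rewrite !mulr_ge0 ?powR_ge0 ?cutoff_ge0. Qed.

Lemma profile_neq0 t : profile t != 0 -> 1 < t < 2 * k ^+ 2.
Proof.
apply: contraNT; rewrite negb_and -!leNgt /profile => /orP[t1|tk].
  by rewrite (@cutoff0 _ (t - 1)) ?mul0r ?mulr0// subr_le0.
rewrite (@cutoff0 _ (2 - _)) ?mulr0// subr_le0 ler_pdivlMr//.
exact: exprn_gt0.
Qed.

Lemma profile_le1 t : 0 <= t -> profile t <= 1.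
Proof.
move=> t0; rewrite -[leRHS]mulr1 ler_pM ?powR_ge0 ?mulr_ge0 ?cutoff_ge0//.
  by rewrite powRN_le1// lerDl.
by rewrite -[leRHS]mulr1 ler_pM ?cutoff_ge0 ?cutoff_le1.
Qed.

Lemma profile_div_sqrt_le1 t : 0 <= t -> profile t / Num.sqrt t <= 1.
Proof.
move=> t0; have [->|/profile_neq0 /andP[t1 _]] := eqVneq (profile t) 0.
  by rewrite mul0r.
rewrite ler_pdivrMr ?sqrtr_gt0 ?(lt_trans _ t1)// mul1r.
by rewrite (le_trans (profile_le1 t0))// -[leLHS]sqrtr1 ler_sqrt// ltW.
Qed.

Lemma profile_ge t : 2 <= t <= k ^+ 2 ->
  (2 * t) `^ (- a) * expinv (expinv 1) ^+ 2 <= profile t.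
Proof.
move=> /andP[t2 tk]; have t0 : 0 < t by exact: lt_le_trans t2.
have k20 : 0 < k ^+ 2 by exact: exprn_gt0.
rewrite /profile !cutoff1.
- rewrite -expr2 ler_wpM2r ?sqr_ge0// le_powRN//.
    by rewrite ltr_pwDl// ltW.
  lra.
- have : t / k ^+ 2 <= 1 by rewrite ler_pdivrMr// mul1r.
  lra.
- lra.
Qed.

(** The left-hand side is the length of the gradient of [x' |-> profile |x'|^2].
    The exact constant [2 a] survives the shift because
    [sqrt t / (1 + t) <= 1 / sqrt t]. *)
Lemma norm_profile_derive_le t : 0 <= t ->
  2 * Num.sqrt t * `|profile_derive t| <=
  2 * a * (profile t / Num.sqrt t) + profile_error t.
Proof.
rewrite le_eqVlt => /predU1P[<-|t0].
  by rewrite /profile_error sqrtr0 invr0 !(mulr0, mul0r) addr0.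
have st0 : 0 < Num.sqrt t by rewrite sqrtr_gt0.
have t1 : 0 < 1 + t by rewrite addr_gt0.
have st : Num.sqrt t / (1 + t) <= (Num.sqrt t)^-1.
  rewrite ler_pdivrMr// mulrC ler_pdivlMr// -expr2 sqr_sqrtr ?(ltW t0)//.
  by rewrite lerDr.
have tP : (1 + t) `^ (- a - 1) = (1 + t) `^ (- a) / (1 + t).
  by rewrite powRD ?powR_inv1 ?(ltW t1)// (gt_eqF t1) implybT.
have := cutoff_le1 (2 - t / k ^+ 2); have := cutoff_le1 (t - 1).
have := cutoff_ge0 (2 - t / k ^+ 2); have := cutoff_ge0 (t - 1).
have := powR_ge0 (1 + t) (- a).
have : 0 <= (k ^+ 2)^-1 by rewrite invr_ge0 sqr_ge0.
rewrite /profile_derive /profile_error /profile tP.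
move: (k ^+ 2)^-1 ((1 + t) `^ _) (cutoff (t - 1)) (cutoff (2 - t / k ^+ 2))
  (cutoff_derive (t - 1)) (cutoff_derive (2 - t / k ^+ 2)) =>
  kV P c1 c2 d1 d2 kV0 P0 c10 c20 c11 c21.
apply: (le_trans (ler_wpM2l _ (ler_normD _ _))).
  by rewrite mulr_ge0// ltW.
rewrite mulrDr lerD//.
  rewrite !normrM normrN (ger0_norm a0) (ger0_norm P0) (ger0_norm c10).
  rewrite (ger0_norm c20) normfV (ger0_norm (ltW t1)).
  rewrite (_ : 2 * Num.sqrt t * _ =
    2 * a * (P * (c1 * c2) * (Num.sqrt t / (1 + t)))); last by ring.
  by rewrite ler_wpM2l ?mulr_ge0// ler_wpM2l ?mulr_ge0.
rewrite normrM (ger0_norm P0) mulrA.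
apply: ler_wpM2l; first by rewrite !mulr_ge0// ltW.
apply: (le_trans (ler_normB _ _)).
rewrite !normrM (ger0_norm c10) (ger0_norm c20).
rewrite (ger0_norm kV0) lerD//; first by rewrite ler_piMr.
by rewrite ler_piMl// mulr_ge0.
Qed.

Lemma profile_error_ge0 t : 0 <= profile_error t.
Proof.
by rewrite !mulr_ge0 ?powR_ge0// addr_ge0// mulr_ge0// invr_ge0 sqr_ge0.
Qed.

Lemma sqrt2_mul_le (x y : R) : 0 <= y -> x <= 2 * y ^+ 2 -> Num.sqrt x <= 2 * y.
Proof.
move=> y0 xy; rewrite -(ler_pXn2r (n := 2)) ?nnegrE ?mulr_ge0//.
have [x0|x0] := leP 0 x; first by rewrite sqr_sqrtr// exprMn; nra.
by rewrite ler0_sqrtr ?(ltW x0)// expr0n sqr_ge0.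
Qed.

(** The inner cutoff varies for [1 <= t <= 2] only, where everything is bounded.
    The outer one varies for [k^2 <= t <= 2 k^2] only, where [(1 + t)^(- a)] is
    at most [k^(-2a)] and the derivative of the cutoff in [x'] is [O(1 / k)]. *)
Lemma profile_error_le t : 0 <= t -> profile_error t <=
  if t <= 2 then 32
  else if t <= 2 * k ^+ 2 then 16 * k `^ (- (2 * a + 1)) else 0.
Proof.
move=> t0; have k20 : 0 < k ^+ 2 by exact: exprn_gt0.
have P0 := powR_ge0 (1 + t) (- a).
have n1 := norm_cutoff_derive (t - 1).
have n2 := norm_cutoff_derive (2 - t / k ^+ 2).
case: ifPn => [t2|].
  have H1 : 2 * Num.sqrt t * (1 + t) `^ (- a) <= 4.
    have : Num.sqrt t <= 2 * 1.
      by apply: sqrt2_mul_le => //; rewrite expr1n mulr1.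
    have : (1 + t) `^ (- a) <= 1 by rewrite powRN_le1// lerDl.
    have := sqrtr_ge0 t; nra.
  have H2 : `|cutoff_derive (t - 1)| +
      `|cutoff_derive (2 - t / k ^+ 2)| / k ^+ 2 <= 8.
    have -> : 8 = 4 + 4 :> R by rewrite -natrD.
    rewrite lerD//.
    by rewrite ler_pdivrMr// (le_trans n2)// ler_pMr// exprn_ege1.
  have -> : 32 = 4 * 8 :> R by rewrite -natrM.
  rewrite /profile_error ler_pM// ?mulr_ge0// addr_ge0// mulr_ge0//.
  by rewrite invr_ge0 ltW.
rewrite -ltNge => t2; rewrite /profile_error cutoff_derive1; last lra.
rewrite normr0 add0r; case: ifPn => [tk|]; last first.
  rewrite -ltNge => tk; rewrite cutoff_derive0 ?normr0 ?mul0r ?mulr0//.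
  by rewrite subr_le0 ler_pdivlMr// ltW.
have [tk'|tk'] := leP t (k ^+ 2).
  rewrite cutoff_derive1 ?normr0 ?mul0r ?mulr0 ?mulr_ge0 ?powR_ge0//.
  have : t / k ^+ 2 <= 1 by rewrite ler_pdivrMr// mul1r.
  lra.
have H1 : Num.sqrt t <= 2 * k by apply: sqrt2_mul_le => //; exact: ltW.
have H2 : (1 + t) `^ (- a) <= k `^ (- (2 * a)).
  rewrite (_ : - (2 * a) = 2%:R * - a); last by ring.
  rewrite powRrM powR_mulrn ?(ltW k0)// le_powRN//; lra.
have -> : k `^ (- (2 * a + 1)) = k `^ (- (2 * a)) / k.
  rewrite opprD powRD; last by rewrite (gt_eqF k0) implybT.
  by rewrite powR_inv1 ?(ltW k0).
rewrite (_ : 16 * _ = 2 * (2 * k) * k `^ (- (2 * a)) * (4 / k ^+ 2));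
  last first.
  by field; rewrite gt_eqF.
apply: ler_pM.
- by rewrite !mulr_ge0.
- by rewrite mulr_ge0// invr_ge0 ltW.
- by apply: ler_pM => //; rewrite ler_wpM2l.
- by rewrite ler_wpM2r// invr_ge0 ltW.
Qed.

End RadialProfile.

(** * The test functions *)

Section TestFunction.
Context {R : realType} {n : nat}.
Variables (N : nat) (leNn : (N <= n)%N) (a k L : R).
Hypotheses (a0 : 0 <= a) (k1 : 1 <= k) (L1 : 1 <= L).

Let k0 : 0 < k. Proof. exact: lt_le_trans k1. Qed.
Let L0 : 0 < L. Proof. exact: lt_le_trans L1. Qed.
Let L20 : 0 < L ^+ 2. Proof. exact: exprn_gt0. Qed.

Definition sqnorm_snd : 'rV[R]_n -> R := sqsum (fun i => (N <= i)%N).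

Let s := @sqnorm_fst R n N.
Let r := sqnorm_snd.

(** The profile in [|x'|], cut off at [|x''| ~ L]. *)
Definition bump (x : 'rV[R]_n) : R :=
  profile a k (s x) * cutoff (2 - r x / L ^+ 2).

Definition cbump (x : 'rV[R]_n) : R[i] := (bump x +i* 0)%C.

Definition split_row (b c : R) : 'rV[R]_n :=
  \row_i if (i < N)%N then b else c.

(** The box [|x_i| <= b] in the coordinates of [x'], [|x_i| <= c] in those of
    [x'']. *)
Definition split_box (b c : R) : set (borel_rV n) :=
  box_rV (split_row (- b) (- c)) (split_row b c).

Let s_ge0 x : 0 <= s x. Proof. exact: sqsum_ge0. Qed.
Let r_ge0 x : 0 <= r x. Proof. exact: sqsum_ge0. Qed.

Lemma sqr_le_sqsum (P : pred 'I_n) (x : 'rV[R]_n) i :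
  P i -> x ord0 i ^+ 2 <= sqsum P x.
Proof.
move=> Pi; rewrite /sqsum (bigD1 i)//= lerDl sumr_ge0// => j _.
exact: sqr_ge0.
Qed.

Lemma split_boxP b c (x : 'rV[R]_n) : 0 <= b -> 0 <= c ->
  s x <= b ^+ 2 -> r x <= c ^+ 2 ->
  split_box b c x.
Proof.
move=> b0 c0 sb rc i; rewrite !mxE.
have H (d : R) : 0 <= d -> x ord0 i ^+ 2 <= d ^+ 2 -> - d <= x ord0 i <= d.
  move=> d0 xd; rewrite -ler_norml -(ler_pXn2r (n := 2)) ?nnegrE//.
  by rewrite real_normK ?num_real.
case: ifPn => iN; apply: H => //.
  by apply: le_trans sb; exact: sqr_le_sqsum.
by apply: le_trans rc; apply: sqr_le_sqsum; rewrite leqNgt.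
Qed.

Lemma Ck_profile j : Ck j (fun x => profile a k (s x)).
Proof.
have Cs : Ck j s by exact: Ck_sqsum.
pose D i (t : R) := (\prod_(l < i) (- a - l%:R)) * t `^ (- a - i%:R).
have C1 : Ck j (fun x => 1 + s x) by apply: Ck_add => //; exact: Ck_cst.
have DD i (t : R) : [set t | 0 < t] t -> is_derive t 1 (D i) (D i.+1 t).
  move=> t0; have := is_deriveM_fun
    (is_derive_cst (\prod_(l < i) (- a - l%:R) : R) t 1)
    (is_derive1_powR (- a - i%:R) t0).
  move/is_derive_eq; apply; rewrite /D big_ord_recr /= mul0r add0r mulrA.
  by congr (_ * _ `^ _); rewrite -addn1 natrD; ring.
have C2 : Ck j (fun x => D 0 (1 + s x)).
  by apply: (Ck_comp 0 DD) => // x; rewrite /= ltr_pwDl.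
have C3 : Ck j (fun x => cutoff (s x - 1)).
  by apply: Ck_cutoff; apply: Ck_add => //; exact: Ck_cst.
have C4 : Ck j (fun x => cutoff (2 - s x / k ^+ 2)).
  apply: Ck_cutoff; rewrite (_ : (fun x => _) =
    fun x => 2 + (- (k ^+ 2)^-1) * s x); last first.
    by apply/funext => x; rewrite mulNr (mulrC _^-1).
  by apply: Ck_add; [|apply: Ck_mul => //]; exact: Ck_cst.
rewrite (_ : (fun x => _) = fun x => D 0%N (1 + s x) *
    (cutoff (s x - 1) * cutoff (2 - s x / k ^+ 2))); last first.
  by apply/funext => x; rewrite /D big_ord0 mul1r subr0.
by apply: Ck_mul => //; exact: Ck_mul.
Qed.

Lemma Ck_bump j : Ck j bump.
Proof.
apply: Ck_mul; first exact: Ck_profile.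
apply: Ck_cutoff; rewrite (_ : (fun x => _) =
    fun x => 2 + (- (L ^+ 2)^-1) * r x); last first.
  by apply/funext => x; rewrite mulNr (mulrC _^-1).
by apply: Ck_add; [|apply: Ck_mul; [|exact: Ck_sqsum]]; exact: Ck_cst.
Qed.

Lemma bump_ge0 x : 0 <= bump x.
Proof. by rewrite mulr_ge0 ?profile_ge0 ?cutoff_ge0. Qed.

Lemma bump_neq0 x : bump x != 0 ->
  [/\ 1 < s x, s x < 2 * k ^+ 2 & r x < 2 * L ^+ 2].
Proof.
rewrite mulf_eq0 negb_or => /andP[/(profile_neq0 k1) /andP[s1 sk] rL].
split => //; rewrite ltNge; apply: contra rL => rL; apply/eqP/cutoff0.
by rewrite subr_le0 ler_pdivlMr.
Qed.

Lemma bump_box x : bump x != 0 -> split_box (2 * k) (2 * L) x.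
Proof.
move=> /bump_neq0[s1 sk rL].
have le24 : 2 <= 2 ^+ 2 :> R by rewrite -natrX ler_nat.
apply: split_boxP; rewrite ?mulr_ge0 ?(ltW k0) ?(ltW L0)// exprMn.
  by apply: ltW (lt_le_trans sk _); rewrite ler_wpM2r// sqr_ge0.
by apply: ltW (lt_le_trans rL _); rewrite ler_wpM2r// sqr_ge0.
Qed.

Lemma normc_cbump x : Normc.normc (cbump x) = bump x.
Proof. by rewrite normcE /= expr0n addr0 sqrtr_sqr ger0_norm ?bump_ge0. Qed.

Lemma test_fun_cbump :
  test_fun [set x : 'rV[R]_n | fst_coords leNn x <> 0] cbump.
Proof.
pose A := [set x : 'rV[R]_n | 1 <= s x] `&` (split_box (2 * k) (2 * L)).
have cs : continuous s by exact: Ck_continuous (Ck_sqsum _ 0).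
have clA : closed A.
  apply: closedI.
    exact: (@closed_comp _ _ s [set t | 1 <= t] (fun x _ => cs x)
      (@closed_ge R 1)).
  apply: compact_closed; last exact: compact_box_rV.
  exact: norm_hausdorff.
have sub : csupport cbump `<=` A.
  rewrite ((closure_id A).1 clA).
  apply: closure_subset => x /=; rewrite /cbump => fx.
  have bx : bump x != 0 by apply: contra_neq fx => ->.
  by split; [case: (bump_neq0 bx) => /ltW|exact: bump_box].
split.
- by move=> j; split; [exact: Ck_bump|exact: Ck_cst].
- apply: (subclosed_compact _ (@compact_box_rV R n
    (split_row (- (2 * k)) (- (2 * L))) (split_row (2 * k) (2 * L)))).
    exact: closed_closure.
  by apply: subset_trans sub _ => x [].
- move=> x /sub[/= s1 _] x0; move: s1.
  rewrite /s (sqnorm_fstE leNn) big1 ?ler10// => i _.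
  have := congr1 (fun v : 'rV[R]_N => v ord0 i) x0; rewrite !mxE => ->.
  by rewrite expr0n.
Qed.

Let psi x := cutoff (2 - r x / L ^+ 2).
Let dpsi x := cutoff_derive (2 - r x / L ^+ 2) / L ^+ 2.

Lemma is_derive_bump i x : is_derive x (delta_mx ord0 i) bump
  (2 * x ord0 i * (if (i < N)%N then profile_derive a k (s x) * psi x
                   else - (profile a k (s x) * dpsi x))).
Proof.
have D1 := is_derive_chain (is_derive_sqsum (fun i => (i < N)%N) i x)
  (is_derive_profile a k (s_ge0 x)).
have D2 := is_derive_chain (is_derive_sqsum (fun i => (N <= i)%N) i x)
  (is_derive_cutoff_affine 2 (- (L ^+ 2)^-1) (r x)).
have := is_deriveM_fun D1 D2.
rewrite (_ : (fun y => _) = bump); last first.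
  by apply/funext => y; rewrite /bump mulNr (mulrC _^-1).
move/is_derive_eq; apply; rewrite /psi /dpsi (leqNgt N i) mulNr (mulrC _^-1).
case: (i < N)%N => /=; rewrite ?mulr1 ?mulr0 ?mul0r ?addr0 ?add0r.
  by ring.
by rewrite mulrN mulNr; ring.
Qed.

(** The squared length is the sum of those of the parts in [x'] and in [x''],
    and its root is at most the sum of their two lengths. *)
Lemma cenorm_cgrad_cbump x : cenorm (cgrad cbump x) <=
  2 * Num.sqrt (s x) * `|profile_derive a k (s x)| * psi x +
  2 * Num.sqrt (r x) * profile a k (s x) * `|dpsi x|.
Proof.
have E i : Normc.normc (cgrad cbump x ord0 i) ^+ 2 =
    (2 * x ord0 i * (if (i < N)%N then profile_derive a k (s x) * psi x
                   else - (profile a k (s x) * dpsi x))) ^+ 2.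
  rewrite mxE normcE sqr_sqrtr ?sqr_sum_ge0//=.
  rewrite (_ : partial i (fun=> 0) x = 0); last exact: derive_cst.
  rewrite expr0n addr0; congr (_ ^+ 2).
  by case: (is_derive_bump i x).
rewrite /cenorm (eq_bigr _ (fun i _ => E i)).
pose X := 2 * Num.sqrt (s x) * (profile_derive a k (s x) * psi x).
pose Y := 2 * Num.sqrt (r x) * (profile a k (s x) * dpsi x).
rewrite [X in Num.sqrt X](_ : _ = X ^+ 2 + Y ^+ 2); last first.
  rewrite (bigID (fun i : 'I_n => (i < N)%N)) /= /X /Y.
  rewrite ![(2 * _ * (_ * _)) ^+ 2]exprMn ![(2 * Num.sqrt _) ^+ 2]exprMn.
  rewrite !sqr_sqrtr//; congr (_ + _).
    rewrite /s /sqnorm_fst /sqsum mulr_sumr mulr_suml; apply: eq_bigr => i ->.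
    by rewrite !exprMn.
  rewrite /r /sqnorm_snd /sqsum mulr_sumr mulr_suml.
  under [RHS]eq_bigl do rewrite leqNgt.
  by apply: eq_bigr => i /negbTE ->; rewrite mulrN sqrrN !exprMn.
apply: (le_trans (sqrt_sqr_sum_le _ _)).
have := cutoff_ge0 (2 - r x / L ^+ 2); have := profile_ge0 a k (s x).
have := sqrtr_ge0 (s x); have := sqrtr_ge0 (r x).
rewrite /X /Y -/(psi x); move: (profile a k _) (profile_derive _ _ _) => P dP.
move: (Num.sqrt _) (Num.sqrt _) (psi x) (dpsi x) => sr ss ps dps r0' s0' P0 ps0.
rewrite !normrM (ger0_norm r0') (ger0_norm s0') (ger0_norm P0) (ger0_norm ps0).
by rewrite ger0_norm// !mulrA.
Qed.

(** The gradient is [2 a] times the Hardy quotient, up to an error that is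
    bounded on a box of fixed size in [x'], and at most of order [k^(-(2a+1))]
    on the rest of the support.  The hypothesis on [L] lets the cutoff in [x''],
    whose contribution is [O(1 / L)], fit in the second term. *)
Lemma cgrad_cbump_le x : L^-1 <= k `^ (- (2 * a + 1)) ->
  cenorm (cgrad cbump x) <= 2 * a * (bump x / Num.sqrt (s x)) +
    48 * (\1_(split_box 2 (2 * L)) x +
          k `^ (- (2 * a + 1)) * \1_(split_box (2 * k) (2 * L)) x).
Proof.
set kap := k `^ _ => Lkap.
have kap0 : 0 <= kap by exact: powR_ge0.
have I1 : 0 <= \1_(split_box 2 (2 * L)) x :> R by rewrite indicE.
have I2 : 0 <= \1_(split_box (2 * k) (2 * L)) x :> R by rewrite indicE.
apply: (le_trans (cenorm_cgrad_cbump x)).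
have psi0 : 0 <= psi x by exact: cutoff_ge0.
have psi1 : psi x <= 1 by exact: cutoff_le1.
have P0 : 0 <= profile a k (s x) by exact: profile_ge0.
have B0 : 0 <= 2 * a * (bump x / Num.sqrt (s x)).
  by rewrite mulr_ge0 ?divr_ge0 ?bump_ge0// mulr_ge0.
have [rL|rL] := leP (2 * L ^+ 2) (r x).
  have LL : 2 - r x / L ^+ 2 <= 0 by rewrite subr_le0 ler_pdivlMr.
  rewrite /psi /dpsi cutoff0// cutoff_derive0// mul0r normr0 !mulr0 addr0.
  by rewrite addr_ge0// mulr_ge0// addr_ge0// mulr_ge0.
have H1 : 2 * Num.sqrt (s x) * `|profile_derive a k (s x)| * psi x <=
    2 * a * (bump x / Num.sqrt (s x)) + profile_error a k (s x).
  apply: (@le_trans _ _ ((2 * a * (profile a k (s x) / Num.sqrt (s x)) +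
      profile_error a k (s x)) * psi x)).
    by rewrite ler_wpM2r// norm_profile_derive_le.
  rewrite mulrDl lerD//; last by rewrite ler_piMr// profile_error_ge0.
  by rewrite /bump -/(psi x) le_eqVlt; apply/orP; left; apply/eqP; ring.
have H2 : 2 * Num.sqrt (r x) * profile a k (s x) * `|dpsi x| <=
    16 * kap * profile a k (s x).
  have sr : Num.sqrt (r x) <= 2 * L by apply: sqrt2_mul_le; exact: ltW.
  rewrite mulrAC ler_wpM2r//.
  apply: (@le_trans _ _ (2 * (2 * L) * (4 / L ^+ 2))).
    apply: ler_pM => //; first by rewrite ler_wpM2l.
    rewrite /dpsi normrM (ger0_norm (x := (L ^+ 2)^-1)) ?invr_ge0 ?(ltW L20)//.
    by rewrite ler_wpM2r ?invr_ge0 ?(ltW L20)// norm_cutoff_derive.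
  rewrite (_ : _ * (4 / L ^+ 2) = 16 * L^-1); last by field; rewrite gt_eqF.
  by rewrite ler_wpM2l.
apply: (le_trans (lerD H1 H2)); rewrite -addrA lerD2l.
have P1 : profile a k (s x) <= 1 by exact: profile_le1.
have PE := profile_error_le a0 k1 (s_ge0 x).
have rL2 : r x <= (2 * L) ^+ 2.
  rewrite (le_trans (ltW rL))// exprMn ler_wpM2r// ?(ltW L20)//.
  by rewrite -natrX ler_nat.
have kap1 : kap <= 1.
  by rewrite -[leRHS](powRr0 k) ler_powR// oppr_le0 addr_ge0// mulr_ge0.
have kapP : 16 * kap * profile a k (s x) <= 16 * kap.
  by rewrite ler_piMr// mulr_ge0.
move: PE; rewrite -/kap; case: ifPn => [s2 PE|].
  have -> : \1_(split_box 2 (2 * L)) x = 1 :> R.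
    rewrite indicE mem_set//; apply: split_boxP => //.
      by rewrite mulr_ge0// ltW.
    by rewrite (le_trans s2)// -natrX ler_nat.
  have : 0 <= kap * \1_(split_box (2 * k) (2 * L)) x by rewrite mulr_ge0.
  lra.
rewrite -ltNge => s2; case: ifPn => [sk PE|].
  have -> : \1_(split_box (2 * k) (2 * L)) x = 1 :> R.
    rewrite indicE mem_set//; apply: split_boxP => //.
    - by rewrite mulr_ge0// ltW.
    - by rewrite mulr_ge0// ltW.
    rewrite (le_trans sk)// exprMn ler_wpM2r// ?sqr_ge0//.
    by rewrite -natrX ler_nat.
  lra.
rewrite -ltNge => sk PE.
have -> : profile a k (s x) = 0.
  apply/eqP; apply: contraTT sk => /(profile_neq0 k1) /andP[_ sk].
  by rewrite -leNgt ltW.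
have : 0 <= kap * \1_(split_box (2 * k) (2 * L)) x by rewrite mulr_ge0.
lra.
Qed.

Lemma hardy_quotient_cbump x :
  Normc.normc (cbump x) / enorm (fst_coords leNn x) = bump x / Num.sqrt (s x).
Proof. by rewrite normc_cbump enorm_fst_coords. Qed.

Lemma bump_div_sqrt_le x :
  0 <= bump x / Num.sqrt (s x) <= 1 * \1_(split_box (2 * k) (2 * L)) x.
Proof.
rewrite divr_ge0 ?bump_ge0//= mul1r indicE.
have [->|bx] := eqVneq (bump x) 0; first by rewrite mul0r.
rewrite mem_set; last exact: bump_box.
rewrite /bump mulrAC -[leRHS]mulr1 ler_pM ?cutoff_ge0 ?cutoff_le1//.
  by rewrite divr_ge0 ?profile_ge0.
exact: profile_div_sqrt_le1.
Qed.

(** Away from the cutoffs the Hardy quotient is comparable to the critical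
    power [|x'|^(-(2a+1))]. *)
Lemma bump_div_sqrt_ge x (T : R) : 0 < T ->
  2 <= s x <= k ^+ 2 -> s x <= T ^+ 2 -> r x <= L ^+ 2 ->
  2 `^ (- a) * expinv (expinv 1) ^+ 3 * T `^ (- (2 * a + 1)) <=
  bump x / Num.sqrt (s x).
Proof.
move=> T0 sk sT rL; have s2 : 2 <= s x by case/andP: sk.
have s0 : 0 < s x by exact: lt_le_trans s2.
have c0 : 0 <= expinv (expinv 1) :> R by exact: expinv_ge0.
rewrite /bump (@cutoff1 _ (2 - _)); last first.
  have : r x / L ^+ 2 <= 1 by rewrite ler_pdivrMr// mul1r.
  lra.
apply: (@le_trans _ _ ((2 * s x) `^ (- a) * expinv (expinv 1) ^+ 2 *
    expinv (expinv 1) / Num.sqrt (s x))); last first.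
  rewrite ler_wpM2r ?invr_ge0 ?sqrtr_ge0// ler_wpM2r//.
  exact: profile_ge.
rewrite powRM ?(ltW s0)//.
rewrite [leRHS](_ : _ = 2 `^ (- a) * expinv (expinv 1) ^+ 3 *
    (s x `^ (- a) / Num.sqrt (s x))); last by ring.
rewrite ler_wpM2l ?mulr_ge0 ?powR_ge0 ?exprn_ge0//.
have -> : T `^ (- (2 * a + 1)) = (T ^+ 2) `^ (- a) / T.
  rewrite -powR_mulrn ?(ltW T0)// -powRrM -powR_inv1 ?(ltW T0)// -powRD.
    by congr (_ `^ _); ring.
  by rewrite (gt_eqF T0) implybT.
apply: ler_pM; rewrite ?powR_ge0 ?invr_ge0 ?(ltW T0)//.
  exact: le_powRN.
rewrite lef_pV2 ?posrE ?sqrtr_gt0//.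
by rewrite -[leRHS](ger0_norm (ltW T0)) -sqrtr_sqr ler_sqrt// sqr_ge0.
Qed.

End TestFunction.

(** * Volumes of boxes and disjoint shells *)

Section Sharpness.
Context {R : realType} {n : nat}.

Section LpRnTheory.
Variables (p : R).
Hypothesis p1 : 1 <= p.

Let p0 : 0 < p. Proof. exact: lt_le_trans p1. Qed.

Local Notation mfunRn g :=
  (measurable_fun setT (g : borel_rV n -> measurableTypeR R)).

Lemma LpRn_ge0 (g : 'rV[R]_n -> R) : (0 <= LpRn p g)%E.
Proof. exact: Lnorm_ge0. Qed.

Lemma le_LpRn_pointwise (g h : 'rV[R]_n -> R) (C : R) : 0 <= C ->
  mfunRn g -> mfunRn h -> (forall x, `|g x| <= C * `|h x|) ->
  (LpRn p g <= C%:E * LpRn p h)%E.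
Proof.
move=> C0 mg mh gh; apply: le_LpRn => //.
have mp (w : 'rV[R]_n -> R) : mfunRn w -> measurable_fun setT
    (fun x : borel_rV n => (`|w x| `^ p)%:E).
  move=> mw; apply/measurable_EFinP.
  apply: (@measurableT_comp _ _ _ _ _ _ (@powR R ^~ p)).
    exact: measurable_powR.
  exact: measurableT_comp.
rewrite -ge0_integralZl_EFin ?powR_ge0//; last exact: mp.
apply: ge0_le_integral => //.
- exact: mp.
- by apply: measurable_funeM; exact: mp.
- move=> x _; rewrite -EFinM lee_fin -powRM//.
  by rewrite ge0_ler_powR// ?nnegrE ?(ltW p0)// mulr_ge0.
Qed.

Lemma LpRn_indic (A : set (borel_rV n)) : measurable A ->
  LpRn p (fun x => \1_A x) = (lebesgue_rV n A `^ p^-1)%E.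
Proof.
move=> mA; rewrite LpRnE; congr (_ `^ _)%E.
have -> : lebesgue_rV n A = (\int[lebesgue_rV n]_x (\1_A x)%:E)%E.
  by rewrite integral_indic// setIT.
apply: eq_integral => x _; rewrite indicE; case: (x \in A).
  by rewrite normr1 powR1.
by rewrite normr0 powR0// gt_eqF.
Qed.

Lemma LpRn_triangle (g h : 'rV[R]_n -> R) : mfunRn g -> mfunRn h ->
  (LpRn p (fun x => (g x + h x)%R) <= LpRn p g + LpRn p h)%E.
Proof. by move=> mg mh; exact: minkowski_EFin. Qed.

End LpRnTheory.

Variables (N : nat) (leNn : (N <= n)%N).
Hypothesis N0 : (0 < N)%N.

Lemma prod_split_row (b c : R) :
  \prod_(i < n) (split_row N b c : 'rV[R]_n) ord0 i = b ^+ N * c ^+ (n - N).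
Proof.
under eq_bigr do rewrite mxE.
rewrite -(big_mkord xpredT (fun i => if (i < N)%N then b else c)).
rewrite (@big_cat_nat _ _ _ N)//=; congr (_ * _).
  rewrite -[in RHS](subn0 N) -prodr_const_nat; apply: eq_big_nat => i.
  by move=> /andP[_ ->].
rewrite -prodr_const_nat; apply: eq_big_nat => i /andP[Ni _].
by rewrite ltnNge Ni.
Qed.

Lemma lebesgue_split_box (b c : R) : 0 <= b -> 0 <= c ->
  lebesgue_rV n (split_box N b c) =
  ((2 * b) ^+ N * (2 * c) ^+ (n - N))%:E.
Proof.
move=> b0 c0; rewrite lebesgue_rV_box => [|i].
  rewrite -prod_split_row; congr EFin; apply: eq_bigr => i _.
  by rewrite !mxE; case: ifP => _; ring.
by rewrite !mxE; case: ifP => _; rewrite ge0_cp.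
Qed.

Section Shells.
Variables (a p k L : R) (J : nat).
Hypotheses (a0 : 0 <= a) (p0 : 0 < p) (pa : p * (2 * a + 1) = N%:R).
Hypotheses (kJ : 3 * n%:R * 4 ^+ J <= k) (L1 : 1 <= L).

Let n0 : (0 < n)%N. Proof. exact: leq_trans leNn. Qed.
Let nR0 : 0 < n%:R :> R. Proof. by rewrite ltr0n. Qed.
Let n1 : 1 <= n%:R :> R. Proof. by rewrite ler1n. Qed.

Definition shell_lo (j : nat) : 'rV[R]_n :=
  \row_i if val i == 0%N then 2 * 4 ^+ j else 0.

Definition shell_hi (j : nat) : 'rV[R]_n :=
  shell_lo j + split_row N (4 ^+ j) (L / n%:R).

(** A box of size [4^j] in [x'] at distance of order [4^j] from [x' = 0], and of
    size [L / n] in [x''], so that [|x''| <= L] on it.  The first coordinate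
    ranges over [2 * 4^j, 3 * 4^j], which keeps the shells disjoint. *)
Definition shell (j : nat) : set (borel_rV n) :=
  box_rV (shell_lo j) (shell_hi j).

Let L0 : 0 < L. Proof. exact: lt_le_trans L1. Qed.
Let T0 j : 0 < 4 ^+ j :> R. Proof. exact: exprn_gt0. Qed.
Let LD : 0 <= L / n%:R. Proof. by rewrite divr_ge0// ltW. Qed.

Lemma lebesgue_shell j :
  lebesgue_rV n (shell j) = ((4 ^+ j) ^+ N * (L / n%:R) ^+ (n - N))%:E.
Proof.
rewrite lebesgue_rV_box => [|i].
  rewrite -prod_split_row; congr EFin; apply: eq_bigr => i _.
  by rewrite !mxE addrAC subrr add0r.
by rewrite !mxE lerDl; case: ifP => _ //; exact: ltW.
Qed.

Lemma shell_disjoint i j x : shell i x -> shell j x -> i = j.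
Proof.
wlog: i j / (i <= j)%N => [H xi xj|].
  by have [ij|/ltnW ji] := leqP i j; [exact: H|exact/esym/H].
rewrite leq_eqVlt => /predU1P[//|ij] /(_ (Ordinal n0)) xi /(_ (Ordinal n0)).
move: xi; rewrite !mxE /= N0 => /andP[_ xi] /andP[xj _].
have : 4 ^+ i.+1 <= 4 ^+ j :> R by rewrite ler_weXn2l// ler1n.
rewrite exprS => Tij; have Ti := T0 i; exfalso; lra.
Qed.

Lemma shell_bounds j x : shell j x ->
  [/\ 2 <= sqnorm_fst N x, sqnorm_fst N x <= (3 * n%:R * 4 ^+ j) ^+ 2 &
      sqnorm_snd N x <= L ^+ 2].
Proof.
move=> xj; have card_le (P : pred 'I_n) (M : R) : 0 <= M ->
    (forall i, P i -> 0 <= x ord0 i <= M) -> sqsum P x <= (n%:R * M) ^+ 2.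
  move=> M0 HM; apply: (@le_trans _ _ (\sum_(i < n) M ^+ 2)).
    rewrite /sqsum [leLHS]big_mkcond /=; apply: ler_sum => i _.
    case: ifP => Pi; last exact: sqr_ge0.
    by have /andP[xi0 xiM] := HM i Pi; rewrite ler_pXn2r.
  rewrite sumr_const card_ord -[leLHS]mulr_natl exprMn ler_wpM2r ?sqr_ge0//.
  by rewrite expr2 ler_peMl// ltW.
have T1 : 1 <= 4 ^+ j :> R by rewrite exprn_ege1// ler1n.
split.
- apply: (@le_trans _ _ (x ord0 (Ordinal n0) ^+ 2)); last first.
    exact: (sqr_le_sqsum (P := fun i => (i < N)%N)).
  have /andP[+ _] := xj (Ordinal n0); rewrite !mxE /= => x2; nra.
- rewrite (_ : 3 * n%:R * _ = n%:R * (3 * 4 ^+ j)); last by ring.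
  apply: card_le; first by rewrite mulr_ge0.
  move=> i iN; have := xj i; rewrite !mxE iN.
  by case: ifP => _ /andP[x1 x2]; apply/andP; split; lra.
- rewrite (_ : L = n%:R * (L / n%:R)); last by field; rewrite gt_eqF.
  apply: card_le => // i iN; have := xj i; rewrite !mxE ltnNge iN /=.
  case: ifP => [/eqP i0|_]; last by rewrite add0r.
  by move: iN; rewrite i0 leqNgt N0.
Qed.

(** The contribution of one shell to the integral, per unit of [L^(n-N)]. *)
Definition shell_const : R :=
  (2 `^ (- a) * expinv (expinv 1) ^+ 3) `^ p *
  (3 * n%:R) `^ (- N%:R) * n%:R ^- (n - N).

Lemma shell_const_gt0 : 0 < shell_const.
Proof.
apply: mulr_gt0; last by rewrite invr_gt0 exprn_gt0.
apply: mulr_gt0; apply: powR_gt0; last by rewrite mulr_gt0.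
by rewrite mulr_gt0 ?powR_gt0// exprn_gt0// cutoff1_gt0.
Qed.

Let H (x : 'rV[R]_n) := bump N a k L x / Num.sqrt (sqnorm_fst N x).
(** A lower bound of [H ^ p] on the j-th shell. *)
Let w j : R := (2 `^ (- a) * expinv (expinv 1) ^+ 3) `^ p *
  (3 * n%:R * 4 ^+ j) `^ (- N%:R).

Let k1 : 1 <= k.
Proof.
apply: le_trans kJ; have : 1 <= 4 ^+ J :> R by rewrite exprn_ege1// ler1n.
have := n1; nra.
Qed.

Let wE j : ((w j)%:E * lebesgue_rV n (shell j) =
  (shell_const * L ^+ (n - N))%:E)%E.
Proof.
rewrite lebesgue_shell -EFinM; congr EFin; rewrite /w /shell_const.
have -> : (3 * n%:R * 4 ^+ j) `^ (- N%:R) =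
    (3 * n%:R) `^ (- N%:R) * (4 ^+ j : R) ^- N.
  by rewrite powRM ?mulr_ge0 ?(ltW (T0 _))//; congr (_ * _);
    rewrite powR_invn ?(ltW (T0 _)).
rewrite expr_div_n; move: (_ `^ p) (_ `^ (- N%:R)) => A B.
by field; rewrite !expf_neq0 ?gt_eqF.
Qed.

Lemma shell_le j x : (j < J)%N -> shell j x -> w j <= H x `^ p.
Proof.
move=> jJ /shell_bounds[s2 sT rL].
have T'0 : 0 < 3 * n%:R * 4 ^+ j :> R by rewrite !mulr_gt0.
have sk : 2 <= sqnorm_fst N x <= k ^+ 2.
  rewrite s2 (le_trans sT)//.
  rewrite ler_pXn2r ?nnegrE ?(ltW T'0) ?(le_trans ler01 k1)//.
  apply: le_trans kJ; rewrite ler_wpM2l ?mulr_ge0// ler_weXn2l ?ler1n//.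
  exact: ltnW.
have := bump_div_sqrt_ge a0 k1 L1 T'0 sk sT rL.
rewrite -/(H x) => Hx.
have Hx0 : 0 <= H x.
  by apply: le_trans Hx; rewrite !mulr_ge0 ?powR_ge0 ?exprn_ge0 ?expinv_ge0.
have -> : w j = (2 `^ (- a) * expinv (expinv 1) ^+ 3 *
    (3 * n%:R * 4 ^+ j) `^ (- (2 * a + 1))) `^ p.
  rewrite [RHS]powRM ?mulr_ge0 ?powR_ge0 ?exprn_ge0 ?expinv_ge0//.
  rewrite -[X in _ = _ * X]powRrM; congr (_ * _ `^ _).
  by rewrite -pa; ring.
rewrite ge0_ler_powR ?nnegrE ?(ltW p0)//.
by rewrite !mulr_ge0 ?powR_ge0 ?exprn_ge0 ?expinv_ge0.
Qed.

(** At the critical exponent [p (2 a + 1) = N] the lower bound of the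
    integrand, of order [4^(-jN)], and the volume [4^(jN)] in [x'] cancel: each
    of the [J] shells contributes the same amount. *)
Lemma integral_hardy_quotient_ge :
  measurable_fun setT (H : borel_rV n -> measurableTypeR R) ->
  ((J%:R * (shell_const * L ^+ (n - N)))%:E <=
   \int[lebesgue_rV n]_x (H x `^ p)%:E)%E.
Proof.
move=> mH; have mS j : measurable (shell j) by exact: measurable_box_rV.
have w0 j : 0 <= w j by rewrite mulr_ge0 ?powR_ge0.
have mI j : measurable_fun setT
    (fun x : borel_rV n => ((w j)%:E * (\1_(shell j) x)%:E)%E).
  by apply: measurable_funeM; apply/measurable_EFinP.
have I0 j x : (0 <= (w j)%:E * (\1_(shell j) x)%:E :> \bar R)%E.
  by rewrite -EFinM lee_fin mulr_ge0.
apply: (@le_trans _ _ (\int[lebesgue_rV n]_x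
    \sum_(j < J) ((w j)%:E * (\1_(shell j) x)%:E))%E).
  rewrite ge0_integral_sum//.
  under eq_bigr => j _.
    rewrite ge0_integralZl_EFin//.
      rewrite integral_indic// setIT wE.
      over.
    by apply/measurable_EFinP.
  by rewrite sumEFin sumr_const card_ord mulr_natl lexx.
apply: ge0_le_integral => //.
- by move=> x _; apply: sume_ge0 => j _.
- exact: emeasurable_sum.
- apply/measurable_EFinP.
  apply: (@measurableT_comp _ _ _ _ _ _ (@powR R ^~ p)) => //.
move=> x _; under eq_bigr do rewrite -EFinM; rewrite sumEFin lee_fin.
have [[j xj]|nx] := pselect (exists j : 'I_J, shell j x); last first.
  rewrite big1 ?powR_ge0// => j _; rewrite indicE memNset ?mulr0// => xj.
  by apply: nx; exists j.
rewrite (bigD1 j)//= big1 ?addr0 => [|i ij].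
  by rewrite indicE mem_set// mulr1; apply: shell_le.
rewrite indicE memNset ?mulr0// => xi; move/eqP: ij; apply.
exact/val_inj/(shell_disjoint xi xj).
Qed.

End Shells.
End Sharpness.

(** * The best constant *)

Section BestConstant.
Context {R : realType}.

(** Write [h] for the norm of the Hardy quotient of the test function.  Its
    gradient has norm at most [2 a h + 96 e], where [e^p = 4^n L^(n-N)] grows
    with [k] through the volume in [x''] only.  As [2 a C < 1], the assumed
    inequality bounds [h] by a multiple of [e], whereas [h^p] is at least [J]
    times a multiple of the same volume. *)
Lemma sharpness_growth_bound (N n : nat) (leNn : (N <= n)%N) (p C : R)
    (J : nat) :
  (0 < N)%N -> 1 < p < N%:R -> 0 < C -> C < p / (N%:R - p) ->
  let a := (N%:R - p) / (2 * p) in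
  (forall f : 'rV[R]_n -> R[i],
    test_fun [set x : 'rV[R]_n | fst_coords leNn x <> 0] f ->
    (LpRn p (fun x => (Normc.normc (f x) / enorm (fst_coords leNn x))%R)
       <= C%:E * LpRn p (fun x => cenorm (cgrad f x)))%E) ->
  J%:R * @shell_const R n N a p <=
  (96 * C / (1 - 2 * a * C)) `^ p * 4 ^+ n.
Proof.
move=> N0 /andP[p1 pN] C0 CN a hardyC.
have n0 : (0 < n)%N by exact: (leq_trans N0 leNn).
have p0 : 0 < p by exact: lt_trans p1.
have Np : 0 < N%:R - p by rewrite subr_gt0.
have a0 : 0 <= a by rewrite divr_ge0 ?mulr_ge0// ltW.
have aE : 2 * a + 1 = N%:R / p by rewrite /a; field; rewrite gt_eqF.
have pa : p * (2 * a + 1) = N%:R by rewrite aE mulrC divfK// gt_eqF.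
have aC : 0 < 1 - 2 * a * C.
  rewrite subr_gt0 (_ : 2 * a = (p / (N%:R - p))^-1); last first.
    by rewrite /a; field; rewrite !gt_eqF.
  by rewrite mulrC ltr_pdivrMr ?mul1r// divr_gt0.
(* Large enough for the first [J] shells to lie in [|x'| <= k]. *)
pose k : R := 3 * n%:R * 4 ^+ J.
have k1 : 1 <= k.
  have : 1 <= n%:R :> R by rewrite ler1n.
  have : 1 <= 4 ^+ J :> R by rewrite exprn_ege1// ler1n.
  rewrite /k; nra.
have k0 : 0 < k by exact: lt_le_trans k1.
(* Any positive [L] with [1 / L <= k^(-N/p)] would do. *)
pose L : R := k ^+ N.
have L1 : 1 <= L by exact: exprn_ege1.
have L0 : 0 < L by exact: lt_le_trans L1.
pose kap : R := k `^ (- (2 * a + 1)).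
have kap0 : 0 <= kap by exact: powR_ge0.
have Lkap : L^-1 <= kap.
  rewrite /L -powR_invn ?(ltW k0)// ler_powR// lerN2 aE ler_pdivrMr//.
  by rewrite ler_peMr// ltW.
pose f := @cbump R n N a k L.
have ft := test_fun_cbump leNn a k1 L1.
pose H (x : 'rV[R]_n) := bump N a k L x / Num.sqrt (sqnorm_fst N x).
pose B1 := @split_box R n N 2 (2 * L).
pose B2 := @split_box R n N (2 * k) (2 * L).
pose D (x : 'rV[R]_n) := cenorm (cgrad f x).
have H_ge0 x : 0 <= H x by case/andP: (bump_div_sqrt_le N a0 k1 L1 x).
have mB1 : measurable B1 by exact: measurable_box_rV.
have mB2 : measurable B2 by exact: measurable_box_rV.
have mIndic (B : set (@borel_rV R n)) : measurable B ->
    measurable_fun setT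
      ((fun x => \1_B x : R) : borel_rV n -> measurableTypeR R).
  by move=> mB; exact: measurable_indic.
have mH : measurable_fun setT (H : borel_rV n -> measurableTypeR R).
  have -> : (H : borel_rV n -> measurableTypeR R) =
      (fun x => bump N a k L x * sqnorm_fst N x `^ (- 2^-1)).
    by apply/funext => x; rewrite /H powRN powR12_sqrt// sqsum_ge0.
  apply: measurable_funM.
    exact: measurable_continuous_rV (Ck_continuous (Ck_bump N a k L 0)).
  apply: (@measurableT_comp _ _ _ _ _ _ (@powR R ^~ (- 2^-1))).
    exact: measurable_powR.
  exact: measurable_continuous_rV (Ck_continuous (Ck_sqsum _ 0)).
have mD : measurable_fun setT (D : borel_rV n -> measurableTypeR R).
  apply: measurable_continuous_rV; apply: continuous_cenorm_cgrad.
  by case: ft => cf _ _; exact: cf.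
pose v1 : R := (2 * 2) ^+ N * (2 * (2 * L)) ^+ (n - N).
have v10 : 0 <= v1 by rewrite mulr_ge0 ?exprn_ge0 ?mulr_ge0 ?(ltW L0).
have v1E : v1 = 4 ^+ n * L ^+ (n - N).
  have E4 : 2 * 2 = 4 :> R by rewrite -natrM.
  by rewrite /v1 [2 * (2 * L)]mulrA E4 exprMn mulrA -exprD subnKC.
pose e : R := v1 `^ p^-1.
have e0 : 0 <= e by exact: powR_ge0.
have LB1 : LpRn p (fun x => \1_B1 x) = e%:E.
  by rewrite LpRn_indic ?(ltW p1)// lebesgue_split_box// mulr_ge0// ltW.
have LB2 : LpRn p (fun x => \1_B2 x) = (k `^ (2 * a + 1) * e)%:E.
  rewrite LpRn_indic ?(ltW p1)// lebesgue_split_box//; last 2 first.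
  - by rewrite mulr_ge0// ltW.
  - by rewrite mulr_ge0// ltW.
  rewrite poweR_EFin; congr EFin.
  rewrite (_ : _ * _ = k ^+ N * v1); last by rewrite /v1 !exprMn; ring.
  rewrite powRM ?exprn_ge0 ?(ltW k0)//; congr (_ * _).
  by rewrite -powR_mulrn ?(ltW k0)// -powRrM aE.
have XB : (LpRn p H < +oo)%E.
  apply: (@le_lt_trans _ _ (1%:E * LpRn p (fun x => \1_B2 x))%E).
    apply: le_LpRn_pointwise => //; [exact: ltW|exact: mIndic|move=> x].
    rewrite ger0_norm// ger0_norm ?indicE//.
    by case/andP: (bump_div_sqrt_le N a0 k1 L1 x).
  by rewrite mul1e LB2 ltry.
have [h h0 hE] : exists2 h : R, 0 <= h & LpRn p H = h%:E.
  exists (fine (LpRn p H)); first by rewrite fine_ge0// LpRn_ge0.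
  by rewrite fineK// ge0_fin_numE// LpRn_ge0.
pose W1 (x : 'rV[R]_n) : R := 2 * a * H x.
pose W2 (x : 'rV[R]_n) : R := 48 * \1_B1 x.
pose W3 (x : 'rV[R]_n) : R := 48 * kap * \1_B2 x.
have mscale (c : R) (g : 'rV[R]_n -> R) :
    measurable_fun setT (g : borel_rV n -> measurableTypeR R) ->
    measurable_fun setT ((fun x => c * g x) : borel_rV n -> measurableTypeR R).
  by move=> mg; apply: measurable_funM.
have LpRn_scale (c : R) (g : 'rV[R]_n -> R) : 0 <= c ->
    measurable_fun setT (g : borel_rV n -> measurableTypeR R) ->
    (LpRn p (fun x => c * g x)%R <= c%:E * LpRn p g)%E.
  move=> c0 mg; apply: le_LpRn_pointwise; rewrite ?(ltW p1)//.
    exact: mscale.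
  by move=> x; rewrite normrM ger0_norm.
have LW : (LpRn p (fun x => W1 x + (W2 x + W3 x))%R <=
           (2 * a * h + 96 * e)%:E)%E.
  have m1 := mscale (2 * a) _ mH.
  have m2 := mscale 48 _ (mIndic _ mB1).
  have m3 := mscale (48 * kap) _ (mIndic _ mB2).
  have m23 := measurable_funD m2 m3.
  apply: (le_trans (LpRn_triangle (ltW p1) m1 m23)).
  rewrite EFinD; apply: leeD.
    rewrite EFinM -hE; apply: LpRn_scale => //; exact: mulr_ge0.
  apply: (le_trans (LpRn_triangle (ltW p1) m2 m3)).
  have -> : 96 * e = 48 * e + 48 * kap * (k `^ (2 * a + 1) * e).
    rewrite -!mulrA [kap * _]mulrA /kap powRN mulVf ?gt_eqF ?powR_gt0//.
    by rewrite mul1r -mulrDl -natrD.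
  rewrite EFinD !(EFinM (_ * _)%R) (EFinM 48 e) -LB1 -LB2.
  by apply: leeD; apply: LpRn_scale; rewrite ?mulr_ge0//; exact: mIndic.
have LD : (LpRn p D <= (2 * a * h + 96 * e)%:E)%E.
  apply: le_trans LW; rewrite -[leRHS]mul1e.
  apply: le_LpRn_pointwise; rewrite ?(ltW p1)//.
    by apply: measurable_funD; [exact: mscale|apply: measurable_funD;
      apply: mscale; exact: mIndic].
  move=> x; rewrite ger0_norm ?sqrtr_ge0// mul1r ger0_norm; last first.
    apply: addr_ge0; first by rewrite mulr_ge0// mulr_ge0.
    by apply: addr_ge0; rewrite mulr_ge0 ?mulr_ge0 ?indicE.
  have := cgrad_cbump_le N a0 k1 L1 x Lkap.
  by rewrite mulrDr [48 * (_ * _)]mulrA.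
have hC : h <= C * (2 * a * h + 96 * e).
  have := hardyC _ ft.
  rewrite (_ : (fun x => _) = H); last first.
    by apply/funext => x; rewrite (hardy_quotient_cbump leNn).
  rewrite hE -lee_fin => /le_trans; apply; rewrite EFinM lee_pmul2l//.
have hM : h <= 96 * C / (1 - 2 * a * C) * e.
  rewrite mulrAC ler_pdivlMr//; lra.
have IH : (\int[lebesgue_rV n]_x (H x `^ p)%:E = (h `^ p)%:E)%E.
  rewrite -poweR_EFin -hE LpRnE -poweRrM mulVf ?gt_eqF// poweRe1.
    by apply: eq_integral => x _; rewrite ger0_norm.
  by apply: integral_ge0 => x _; rewrite lee_fin powR_ge0.
have := integral_hardy_quotient_ge leNn N0 a0 p0 pa (lexx k) L1 mH.
rewrite IH lee_fin mulrA => JI.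
have hp : h `^ p <= (96 * C / (1 - 2 * a * C)) `^ p * 4 ^+ n * L ^+ (n - N).
  have M0 : 0 <= 96 * C / (1 - 2 * a * C).
    by rewrite divr_ge0 ?mulr_ge0// ltW.
  apply: (@le_trans _ _ ((96 * C / (1 - 2 * a * C) * e) `^ p)).
    by rewrite ge0_ler_powR ?nnegrE ?(ltW p0)// mulr_ge0.
  rewrite powRM// /e -powRrM mulVf ?gt_eqF// powRr1// v1E mulrA.
  exact: lexx.
by rewrite -(ler_pM2r (exprn_gt0 (n - N) L0)) (le_trans JI).
Qed.

Theorem hardy_constant_sharp (N n : nat) (leNn : (N <= n)%N) (p C : R) :
  (0 < N)%N -> 1 < p < N%:R ->
  (forall f : 'rV[R]_n -> R[i],
    test_fun [set x : 'rV[R]_n | fst_coords leNn x <> 0] f ->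
    (LpRn p (fun x => (Normc.normc (f x) / enorm (fst_coords leNn x))%R)
       <= C%:E * LpRn p (fun x => cenorm (cgrad f x)))%E) ->
  p / (N%:R - p) <= C.
Proof.
move=> N0 hp hC; rewrite leNgt; apply/negP => CC0.
have /andP[p1 pN] := hp.
have C00 : 0 < p / (N%:R - p).
  by rewrite divr_gt0 ?subr_gt0// (lt_trans ltr01).
(* A larger constant that is positive and still below the critical one. *)
pose C' := Num.max C (p / (N%:R - p) / 2).
have C'0 : 0 < C' by rewrite lt_max divr_gt0 ?orbT.
have C'C0 : C' < p / (N%:R - p).
  by rewrite gt_max CC0 gtr_pMr// invf_lt1// ltr1n.
pose a := (N%:R - p) / (2 * p).
have c0 := @shell_const_gt0 R n N leNn N0 a p.
pose M := (96 * C' / (1 - 2 * a * C')) `^ p * 4 ^+ n.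
have H J : J%:R * @shell_const R n N a p <= M.
  apply: (sharpness_growth_bound J N0 hp C'0 C'C0) => f /hC /le_trans; apply.
  apply: lee_wpmul2r; first exact: LpRn_ge0.
  by rewrite lee_fin le_max lexx.
have := H (Num.truncn (M / @shell_const R n N a p)).+1.
by rewrite -ler_pdivlMr// leNgt truncnS_gt.
Qed.

End BestConstant.

(** * The sharp inequality *)

Theorem mainTheorem4 (R : realType) (N n : nat) (p : R)
    (hN : (2 <= N)%N) (hNn : (N <= n)%N) (hp : 1 < p < N%:R) :
  let U := [set x : 'rV[R]_n | fst_coords hNn x <> 0] in
  let hardy (C : R) := forall f : 'rV[R]_n -> R[i], test_fun U f ->
    (LpRn p (fun x => (Normc.normc (f x) / enorm (fst_coords hNn x))%R)
       <= C%:E * LpRn p (fun x => cenorm (cgrad f x)))%E in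
  hardy (p / (N%:R - p)) /\ (forall C : R, hardy C -> p / (N%:R - p) <= C).
Proof.
split=> [f|C hardyC]; first exact: hardy_inequality.
apply: (hardy_constant_sharp (leNn := hNn) _ hp hardyC).
exact: leq_trans hN.
Qed.
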